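(* Let $f\in\operatorname{Rec}_2$ and let $\mathcal{P}$ be a setwise $\mathbb{Q}$-free partition of $[0,1)^2$ into rectangles associated with $f$. Then there exists a finite sequence $(r_1,\dots,r_n)$ of restricted shuffles on $\mathcal{P}$ such that $f=r_n\circ\cdots\circ r_1$.
   Context: A rectangle in $\mathbb{R}^d$ is a set $\prod_{i=1}^d[a_i,b_i)$ with $a_i<b_i$ real. $\operatorname{Rec}_d$ is the group of bijections $f$ of $[0,1)^d$ for which there is a finite partition of $[0,1)^d$ into rectangles on each of which $f$ is a translation; such a partition is said to be associated with $f$. Writing $\operatorname{pr}_i$ for the $i$-th coordinate projection and $\lambda$ for Lebesgue measure, a partition $\mathcal{P}$ into rectangles is setwise $\mathbb{Q}$-free if for each $i$ the set $\{\lambda(\operatorname{pr}_i(K)):K\in\mathcal{P}\}$ (as a set, without repetitions) is $\mathbb{Q}$-linearly independent. A restricted shuffle: for a rectangle $P=\prod_j[a_j,b_j)$, an index $i$ and $c\in(a_i,b_i)$, let $P'$ (resp. $P''$) be obtained from $P$ by replacing $[a_i,b_i)$ by $[a_i,c)$ (resp. $[c,b_i)$); the restricted shuffle is translation by $(b_i-c)e_i$ on $P'$, by $-(c-a_i)e_i$ on $P''$, identity outside $P$; it is said to shuffle $P'$ and $P''$. A restricted shuffle on a partition $\mathcal{Q}$ is a restricted shuffle that shuffles two rectangles $P',P''$ both belonging to $\mathcal{Q}$. A sequence $(r_1,\dots,r_n)$ of restricted shuffles on $\mathcal{P}$ is a sequence such that each $r_k$ is a restricted shuffle on the partition $r_{k-1}\circ\cdots\circ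 r_1(\mathcal{P})=\{r_{k-1}\circ\cdots\circ r_1(K):K\in\mathcal{P}\}$. *)

(* Defs.v *)
From Stdlib Require Import Reals Lra List QArith Qreals.
Open Scope R_scope.

Definition pt := (R * R)%type.
Inductive coord := C1 | C2.
Definition pr (i : coord) (p : pt) : R := match i with C1 => fst p | C2 => snd p end.
Definition padd (p q : pt) : pt := (fst p + fst q, snd p + snd q).
Definition evec (i : coord) (t : R) : pt := match i with C1 => (t, 0) | C2 => (0, t) end.
Definition upd (i : coord) (p : pt) (t : R) : pt :=
  match i with C1 => (t, snd p) | C2 => (fst p, t) end.

Record rect := mkRect { rlo : pt; rhi : pt }.
Definition rect_ok (K : rect) : Prop := forall i, pr i (rlo K) < pr i (rhi K).
Definition rect_set (K : rect) (x : pt) : Prop :=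
  forall i, pr i (rlo K) <= pr i x < pr i (rhi K).
Definition in_unit (x : pt) : Prop := forall i, 0 <= pr i x < 1.

Definition len (i : coord) (K : rect) : R := pr i (rhi K) - pr i (rlo K).

Definition is_rect_partition (P : list rect) : Prop :=
  NoDup P /\
  (forall K, In K P -> rect_ok K) /\
  (forall K L, In K P -> In L P -> K <> L -> forall x, ~ (rect_set K x /\ rect_set L x)) /\
  (forall x, in_unit x <-> exists K, In K P /\ rect_set K x).

(** f is a bijection of [0,1)^2 (values outside the square are irrelevant). *)
Definition bij_unit (f : pt -> pt) : Prop :=
  (forall x, in_unit x -> in_unit (f x)) /\
  (forall x y, in_unit x -> in_unit y -> f x = f y -> x = y) /\
  (forall y, in_unit y -> exists x, in_unit x /\ f x = y).

Definition associated (P : list rect) (f : pt -> pt) : Prop :=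
  is_rect_partition P /\
  forall K, In K P -> exists v : pt, forall x, rect_set K x -> f x = padd x v.

Definition in_Rec2 (f : pt -> pt) : Prop :=
  bij_unit f /\ exists P, associated P f.

Definition Q_lin_indep (S : R -> Prop) : Prop :=
  forall l : list (R * Q),
    NoDup (map fst l) ->
    (forall p, In p l -> S (fst p)) ->
    fold_right (fun p acc => Q2R (snd p) * fst p + acc) 0 l = 0 ->
    forall p, In p l -> Qeq (snd p) 0%Q.

Definition setwise_Qfree (P : list rect) : Prop :=
  forall i, Q_lin_indep (fun r => exists K, In K P /\ r = len i K).

Record shuffle_data := mkShuffle { sh_rect : rect; sh_coord : coord; sh_cut : R }.

Definition in_rectb (K : rect) (x : pt) : bool :=
  if Rle_dec (fst (rlo K)) (fst x) then
  if Rlt_dec (fst x) (fst (rhi K)) then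
  if Rle_dec (snd (rlo K)) (snd x) then
  if Rlt_dec (snd x) (snd (rhi K)) then true else false else false else false else false.

Definition shuffle_valid (s : shuffle_data) : Prop :=
  rect_ok (sh_rect s) /\
  pr (sh_coord s) (rlo (sh_rect s)) < sh_cut s < pr (sh_coord s) (rhi (sh_rect s)).

Definition sh_left (s : shuffle_data) : rect :=
  mkRect (rlo (sh_rect s)) (upd (sh_coord s) (rhi (sh_rect s)) (sh_cut s)).
Definition sh_right (s : shuffle_data) : rect :=
  mkRect (upd (sh_coord s) (rlo (sh_rect s)) (sh_cut s)) (rhi (sh_rect s)).

Definition shuffle (s : shuffle_data) (x : pt) : pt :=
  let i := sh_coord s in
  let a := pr i (rlo (sh_rect s)) in
  let b := pr i (rhi (sh_rect s)) in
  let c := sh_cut s in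
  if in_rectb (sh_rect s) x then
    if Rlt_dec (pr i x) c then padd x (evec i (b - c))
    else padd x (evec i (- (c - a)))
  else x.

Definition apply_seq (rs : list shuffle_data) (x : pt) : pt :=
  fold_left (fun y s => shuffle s y) rs x.

Definition image_set (g : pt -> pt) (K : rect) (y : pt) : Prop :=
  exists x, rect_set K x /\ y = g x.

(** s is a restricted shuffle on the partition g(P) = {g(K) : K in P}. *)
Definition shuffle_on (P : list rect) (g : pt -> pt) (s : shuffle_data) : Prop :=
  shuffle_valid s /\
  (exists K, In K P /\ forall y, image_set g K y <-> rect_set (sh_left s) y) /\
  (exists K, In K P /\ forall y, image_set g K y <-> rect_set (sh_right s) y).

Definition shuffle_seq_on (P : list rect) (rs : list shuffle_data) : Prop :=
  forall k s, nth_error rs k = Some s -> shuffle_on P (apply_seq (firstn k rs)) s.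

(* Main.v *)
Require Import Defs.
From Stdlib Require Import Reals List QArith Qreals.
From Stdlib Require Import Lra Lia Permutation Arith.PeanoNat.
Import Defs ListNotations. (* [Reals] shadows the constructor [C1] *)
Open Scope R_scope.

(** Setwise Q-freeness makes the following rigid: two families of side lengths (with multiplicity)
    in a given direction have equal sums only if they are equal. Swapping two rectangles that share
    a full side is reversible, so it suffices to connect both [P] and [f(P)] to a common tiling.

    View a tiling as a coarse tiling by blocks, each block being a grid of rectangles; initially
    every rectangle is a block. The columns, or the rows, of a grid can be permuted by shuffles. If
    there are several blocks, take the one, T, at the corner of the square. At its opposite corner
    at most one of its two free sides can be overlapped by a neighbour, so one free side of T is a
    union of full sides of neighbours B_1, ..., B_l. By rigidity the side lengths of T along it are
    those of the B_k up to order; permute the lines of T accordingly, cut T into l pieces and glue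
    the k-th piece to B_k. This removes one block, so eventually the whole square is one grid.

    By rigidity again the two grids so obtained have, up to permutation, the same columns and rows,
    so they differ by a permutation of rectangles of equal size; two such rectangles in one line can
    be exchanged by shuffles, and any two by conjugating an exchange in a column by one in a row. *)

(** * Coordinates and sums of lists *)

Definition ot (i : coord) : coord := match i with C1 => C2 | C2 => C1 end.

Lemma ot_ot i : ot (ot i) = i.
Proof. now destruct i. Qed.

Lemma coord_cases i j : j = i \/ j = ot i.
Proof. destruct i, j; auto. Qed.

Definition sel {A} (i : coord) (a b : A) : coord -> A :=
  fun j => match i, j with C1, C1 => a | C2, C2 => a | _, _ => b end.

Lemma sel_same {A} i (a b : A) : sel i a b i = a.
Proof. now destruct i. Qed.

Lemma sel_ot {A} i (a b : A) : sel i a b (ot i) = b.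
Proof. now destruct i. Qed.

Lemma rect_eq_dec (K L : rect) : {K = L} + {K <> L}.
Proof. repeat decide equality; apply Req_EM_T. Qed.

Definition sumR (l : list R) : R := fold_right Rplus 0 l.

Lemma sumR_app l l' : sumR (l ++ l') = sumR l + sumR l'.
Proof. induction l as [|a l IH]; simpl; [|rewrite IH]; lra. Qed.

Lemma sumR_perm l l' : Permutation l l' -> sumR l = sumR l'.
Proof. induction 1; simpl; lra. Qed.

Lemma NoDup_app_disj {A} (l l' : list A) k : NoDup (l ++ l') -> In k l -> In k l' -> False.
Proof.
  induction l as [|a l IH]; simpl; [tauto|].
  intros H [->|Hk] Hk'; inversion H; subst; auto.
  apply H2, in_or_app; auto.
Qed.

(** * Placements and grids *)

(** A placement gives the current lower corner of each rectangle. *)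
Definition placement := rect -> coord -> R.

Section Placements.

Variable S : list rect.
Hypothesis S_nodup : NoDup S.
Hypothesis S_ok : forall K, In K S -> rect_ok K.

Lemma len_pos K i : In K S -> 0 < len i K.
Proof. intros H. generalize (S_ok K H i). unfold len. lra. Qed.

(** The restricted shuffle as seen on lower corners. No tiling is assumed, so swaps can be composed
    and reversed without tracking disjointness; that enters only when swaps are turned back into
    maps. *)
Definition swap_step (p q : placement) : Prop :=
  exists i K L, In K S /\ In L S /\ K <> L /\
    p L i = p K i + len i K /\ p L (ot i) = p K (ot i) /\
    len (ot i) K = len (ot i) L /\
    q L i = p K i /\ q K i = p K i + len i L /\
    q K (ot i) = p K (ot i) /\ q L (ot i) = p L (ot i) /\
    forall M, In M S -> M <> K -> M <> L -> forall j, q M j = p M j.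

(** The base case is pointwise agreement on [S] rather than equality, since placements are functions
    and are compared on [S] only. *)
Inductive conn : placement -> placement -> Prop :=
| conn_ext p q : (forall K, In K S -> forall j, p K j = q K j) -> conn p q
| conn_step p q r : swap_step p q -> conn q r -> conn p r.

Lemma swap_step_ext p p' q : (forall K, In K S -> forall j, p K j = p' K j) ->
  swap_step p' q -> swap_step p q.
Proof.
  intros E (i & K & L & HK & HL & n & H1 & H2 & H3 & H4 & H5 & H6 & H7 & H8).
  exists i, K, L. repeat (split; [solve [auto | rewrite ?E by auto; auto]|]).
  intros M HM nK nL j. rewrite E by auto. auto.
Qed.

Lemma swap_step_sym p q : swap_step p q -> swap_step q p.
Proof.
  intros (i & K & L & HK & HL & n & H1 & H2 & H3 & H4 & H5 & H6 & H7 & H8).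
  exists i, L, K. repeat (split; [solve [auto | congruence | lra]|]).
  intros M HM nK nL j. symmetry; auto.
Qed.

Lemma conn_refl p : conn p p.
Proof. now apply conn_ext. Qed.

Lemma conn_trans p q r : conn p q -> conn q r -> conn p r.
Proof.
  induction 1 as [p q E|p q s St C IH]; intros H.
  - destruct H as [q r E'|q q' r St C].
    + apply conn_ext. intros K HK j. rewrite E; auto.
    + eapply conn_step; [|exact C]. eapply swap_step_ext; eauto.
  - eapply conn_step; [exact St|]; auto.
Qed.

Lemma conn_sym p q : conn p q -> conn q p.
Proof.
  induction 1 as [p q E|p q s St C IH].
  - apply conn_ext. intros; symmetry; auto.
  - eapply conn_trans; [exact IH|]. eapply conn_step; [apply swap_step_sym, St|apply conn_refl].
Qed.

(** The second clause lets a grid disjoint from [l] be carried unchanged to the new placement. *)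
Definition moves_only (l : list rect) (p q : placement) : Prop :=
  conn p q /\ forall K, ~ In K l -> forall j, p K j = q K j.

Lemma moves_only_incl l l' p q : incl l l' -> moves_only l p q -> moves_only l' p q.
Proof. intros H [C E]; split; auto. Qed.

(** [line i p x y h l]: under [p] the rectangles of [l] all have extent [h] transversally to
    direction [i] and stand one after the other in direction [i], starting at [x], at height [y]. *)
Fixpoint line (i : coord) (p : placement) (x y h : R) (l : list rect) : Prop :=
  match l with
  | [] => True
  | K :: l' => p K i = x /\ p K (ot i) = y /\ len (ot i) K = h /\
               line i p (x + len i K) y h l'
  end.

Lemma line_ext i p q x y h l : (forall K, In K l -> forall j, p K j = q K j) ->
  line i p x y h l -> line i q x y h l.
Proof.
  revert x; induction l as [|K l IH]; simpl; auto.
  intros x E (H1 & H2 & H3 & H4). rewrite <- !E by auto.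
  repeat (split; [auto|]). apply IH; auto.
Qed.

Lemma line_det i p q x y h l : line i p x y h l -> line i q x y h l ->
  forall K, In K l -> forall j, p K j = q K j.
Proof.
  revert x; induction l as [|L l IH]; simpl; intros x; [tauto|].
  intros (H1 & H2 & H3 & H4) (H1' & H2' & H3' & H4') K [<-|HK] j.
  - destruct (coord_cases i j) as [-> | ->]; congruence.
  - eapply IH; eauto.
Qed.

Lemma line_app i p x y h l l' : line i p x y h (l ++ l') <->
  line i p x y h l /\ line i p (x + sumR (map (len i) l)) y h l'.
Proof.
  revert x; induction l as [|K l IH]; simpl; intros x.
  - rewrite Rplus_0_r. tauto.
  - rewrite IH, Rplus_assoc. tauto.
Qed.

Lemma line_width i p x y h l K : line i p x y h l -> In K l -> len (ot i) K = h.
Proof.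
  revert x; induction l as [|L l IH]; simpl; intros x; [tauto|].
  intros (H1 & H2 & H3 & H4) [<-|HK]; eauto.
Qed.

Lemma line_height i p x y h l K : line i p x y h l -> In K l -> p K (ot i) = y.
Proof.
  revert x; induction l as [|L l IH]; simpl; intros x; [tauto|].
  intros (H1 & H2 & H3 & H4) [<-|HK]; eauto.
Qed.

Fixpoint place (i : coord) (x y : R) (l : list rect) (p : placement) : placement :=
  match l with
  | [] => p
  | K :: l' => fun M => if rect_eq_dec M K then sel i x y
                        else place i (x + len i K) y l' p M
  end.

Lemma place_out i x y l p K j : ~ In K l -> place i x y l p K j = p K j.
Proof.
  revert x; induction l as [|L l IH]; simpl; intros x H; auto.
  destruct (rect_eq_dec K L); [subst; tauto|]. apply IH; tauto.
Qed.

Lemma place_line i x y h l p : NoDup l -> (forall K, In K l -> len (ot i) K = h) ->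
  line i (place i x y l p) x y h l.
Proof.
  revert x; induction l as [|K l IH]; simpl; auto. intros x ND W.
  inversion ND; subst.
  destruct (rect_eq_dec K K) as [_|]; [|tauto].
  rewrite sel_same, sel_ot. repeat (split; [auto|]).
  eapply line_ext; [|apply IH; auto]. intros L HL j. simpl.
  destruct (rect_eq_dec L K); [subst; tauto|]. reflexivity.
Qed.

(** Adjacent transpositions generate all permutations, and each of them is one swap. *)
Lemma line_permute i p q x y h l l' : Permutation l l' -> NoDup l -> incl l S ->
  line i p x y h l -> line i q x y h l' ->
  (forall K, ~ In K l -> forall j, p K j = q K j) -> conn p q.
Proof.
  intros Hp; revert x p q.
  induction Hp as [|K l l' Hp IH|K L l|l l' l'' Hp IH Hp' IH']; intros x p q ND I Lp Lq E.
  - apply conn_ext; auto.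
  - simpl in Lp, Lq. destruct Lp as (H1 & H2 & H3 & H4), Lq as (H1' & H2' & H3' & H4').
    inversion ND; subst. eapply IH; eauto.
    + intros M HM; apply I; simpl; auto.
    + intros M HM j. destruct (rect_eq_dec M K) as [->|n].
      * destruct (coord_cases i j) as [-> | ->]; congruence.
      * apply E. simpl; intuition.
  - simpl in Lp, Lq.
    destruct Lp as (H1 & H2 & H3 & H4 & H5 & H6 & H7), Lq as (G1 & G2 & G3 & G4 & G5 & G6 & G7).
    eapply conn_step; [|apply conn_refl].
    exists i, L, K. inversion ND as [|? ? n1 ND']; inversion ND' as [|? ? n2 ND'']; subst.
    split; [apply I; simpl; auto|]. split; [apply I; simpl; auto|].
    split; [intros ->; apply n1; simpl; auto|].
    repeat (split; [solve [auto | congruence | lra]|]).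
    (* After the two exchanged rectangles the line resumes at the same point in either order. *)
    intros M HM nL nK j. symmetry. destruct (in_dec rect_eq_dec M l) as [i0|n].
    + eapply line_det; [exact H7| |exact i0].
      replace (p L i + len i L + len i K) with (p L i + len i K + len i L) by lra. exact G7.
    + apply E. simpl; intuition.
  (* The intermediate order comes without a placement; [place] supplies one. *)
  - assert (ND' : NoDup l') by (eapply Permutation_NoDup; eauto).
    assert (Lm : line i (place i x y l' p) x y h l').
    { apply place_line; auto. intros K HK. eapply line_width; [exact Lp|].
      eapply Permutation_in; [symmetry; exact Hp|auto]. }
    apply conn_trans with (place i x y l' p).
    + eapply IH; eauto. intros K HK j. rewrite place_out; auto.
      intros HK'; apply HK. eapply Permutation_in; [symmetry; exact Hp|auto].
    + eapply IH'; eauto.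
      * intros K HK; apply I. eapply Permutation_in; [symmetry; exact Hp|auto].
      * intros K HK j. rewrite place_out by auto. apply E.
        intros HK'; apply HK. eapply Permutation_in; eauto.
Qed.

Lemma line_reorder i p x y h l l' : Permutation l l' -> NoDup l -> incl l S ->
  line i p x y h l -> exists q, line i q x y h l' /\ moves_only l p q.
Proof.
  intros Hp ND I Lp.
  assert (Lq : line i (place i x y l' p) x y h l').
  { apply place_line; [eapply Permutation_NoDup; eauto|].
    intros K HK. eapply line_width; [exact Lp|].
    eapply Permutation_in; [symmetry; exact Hp|auto]. }
  assert (E : forall K, ~ In K l -> forall j, p K j = place i x y l' p K j).
  { intros K HK j. rewrite place_out; auto.
    intros HK'; apply HK. eapply Permutation_in; [symmetry; exact Hp|auto]. }
  exists (place i x y l' p). split; [auto|split; [|auto]].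
  eapply line_permute; eauto.
Qed.

(** [rows i p x y cs rs R]: the lists in [R] are consecutive lines in direction [i], all with the
    lengths [cs], whose transversal extents are [rs]; together they form a grid. *)
Fixpoint rows (i : coord) (p : placement) (x y : R) (cs rs : list R) (R : list (list rect)) : Prop :=
  match rs, R with
  | [], [] => True
  | r :: rs', l :: R' => line i p x y r l /\ map (len i) l = cs /\ rows i p x (y + r) cs rs' R'
  | _, _ => False
  end.

Lemma rows_ext i p q x y cs rs R : (forall K, In K (concat R) -> forall j, p K j = q K j) ->
  rows i p x y cs rs R -> rows i q x y cs rs R.
Proof.
  revert y R; induction rs as [|r rs IH]; intros y [|l R] E; simpl; auto.
  intros (H1 & H2 & H3). simpl in E. split; [|split; [auto|]].
  - eapply line_ext; [|exact H1]. intros; apply E, in_or_app; auto.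
  - apply IH; auto. intros; apply E, in_or_app; auto.
Qed.

(** The first rectangles of all rows share the length [c] and, being stacked, form a line in the
    other direction: the first column. *)
Lemma rows_uncons i p x y c cs rs R : rows i p x y (c :: cs) rs R ->
  exists col R', line (ot i) p y x c col /\ map (len (ot i)) col = rs /\
    rows i p (x + c) y cs rs R' /\ Permutation (col ++ concat R') (concat R).
Proof.
  revert y R; induction rs as [|r rs IH]; intros y [|l R]; simpl; try tauto.
  - intros _. exists [], []. simpl. auto.
  - intros (H1 & H2 & H3). destruct l as [|K l]; [discriminate|].
    simpl in H1, H2. injection H2 as H2 H2'. destruct H1 as (G1 & G2 & G3 & G4).
    destruct (IH _ _ H3) as (col & R' & A & B & C & D).
    exists (K :: col), (l :: R'). simpl. rewrite ot_ot, G3.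
    repeat split; auto; try congruence.
    + constructor. rewrite <- D, !app_assoc. apply Permutation_app_tail, Permutation_app_comm.
Qed.

(** Columns are peeled off one at a time. Thanks to this, statements about rows apply to columns as
    well. *)
Lemma rows_transpose i p x y cs rs R : rows i p x y cs rs R ->
  exists R', rows (ot i) p y x rs cs R' /\ Permutation (concat R') (concat R).
Proof.
  revert x R; induction cs as [|c cs IH]; intros x R H.
  (* With no columns left there may still be rows, but all of them are empty. *)
  - exists []. split; [exact I|]. simpl.
    replace (concat R) with (@nil rect); [auto|].
    revert y R H; induction rs as [|r rs IH]; intros y [|l R]; simpl; try tauto.
    intros (_ & H2 & H3). apply map_eq_nil in H2. subst. simpl. eauto.
  - destruct (rows_uncons _ _ _ _ _ _ _ _ H) as (col & R1 & A & B & C & D).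
    destruct (IH _ _ C) as (R2 & E & F).
    exists (col :: R2). simpl. repeat split; auto.
    rewrite F; exact D.
Qed.

(** All rows have the same lengths and no two share a rectangle, so the rearrangement is carried out
    in each row separately. *)
Lemma rows_reorder i p x y cs cs' rs R : rows i p x y cs rs R -> Permutation cs cs' ->
  NoDup (concat R) -> incl (concat R) S ->
  exists q R', rows i q x y cs' rs R' /\ moves_only (concat R) p q /\
    Permutation (concat R') (concat R).
Proof.
  intros H Hp. revert y p R H; induction rs as [|r rs IH]; intros y p [|l R]; simpl; try tauto.
  - intros _ _ _. exists p, []. simpl. repeat split; auto. apply conn_refl.
  - intros (H1 & H2 & H3) ND I.
    assert (I1 : incl l S) by (intros K HK; apply I, in_or_app; auto).
    assert (I2 : incl (concat R) S) by (intros K HK; apply I, in_or_app; auto).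
    destruct (IH _ _ _ H3 (NoDup_app_remove_l _ _ ND) I2) as (q & R' & A & [B1 B2] & C).
    symmetry in Hp. rewrite <- H2 in Hp.
    (* A rearrangement of the lengths lifts to one of the rectangles. *)
    destruct (Permutation_map_inv _ _ Hp) as (l' & E & F).
    destruct (line_reorder i q x y r l l') as (q' & Lq & [M1 M2]); auto.
    { eapply NoDup_app_remove_r; eauto. }
    { eapply line_ext; [|exact H1]. intros K HK j. apply B2.
      intros HK'; eapply NoDup_app_disj; eauto. }
    exists q', (l' :: R'). simpl. split; [split; [auto|split; [congruence|]]|split; [split|]].
    + eapply rows_ext; [|exact A]. intros K HK j. apply M2.
      intros HK'. eapply NoDup_app_disj; eauto. eapply Permutation_in; eauto.
    + eapply conn_trans; eauto.
    + intros K HK j. rewrite B2, M2; auto; intros HK'; apply HK, in_or_app; auto.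
    + apply Permutation_app; auto. now symmetry.
Qed.

Lemma rows_app i p x y cs rs rs' R : rows i p x y cs (rs ++ rs') R ->
  exists R1 R2, R = R1 ++ R2 /\ rows i p x y cs rs R1 /\ rows i p x (y + sumR rs) cs rs' R2.
Proof.
  revert y R; induction rs as [|r rs IH]; simpl; intros y R H.
  - exists [], R. rewrite Rplus_0_r. simpl; auto.
  - destruct R as [|l R]; [tauto|]. destruct H as (H1 & H2 & H3).
    destruct (IH _ _ H3) as (R1 & R2 & -> & A & B).
    exists (l :: R1), R2. simpl. rewrite <- Rplus_assoc. auto.
Qed.

(** Gluing works row by row and so needs the same [rs] in the same order on both sides; this is why
    lines are permuted before a merge. *)
Lemma rows_join i p x y cs cs' rs R R' :
  rows i p x y cs rs R -> rows i p (x + sumR cs) y cs' rs R' ->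
  exists R'', rows i p x y (cs ++ cs') rs R'' /\
    Permutation (concat R'') (concat R ++ concat R').
Proof.
  revert y R R'; induction rs as [|r rs IH]; simpl; intros y [|l R] [|l' R']; try tauto.
  - intros _ _. exists []. simpl; auto.
  - intros (H1 & H2 & H3) (H1' & H2' & H3').
    destruct (IH _ _ _ H3 H3') as (R'' & A & B).
    exists ((l ++ l') :: R''). simpl. split; [split; [|split; [|auto]]|].
    + apply line_app. rewrite H2. auto.
    + rewrite map_app; congruence.
    + rewrite B, <- !app_assoc. apply Permutation_app_head.
      rewrite !app_assoc. apply Permutation_app_tail, Permutation_app_comm.
Qed.

Lemma rows_line i p x y cs rs R K : rows i p x y cs rs R -> In K (concat R) ->
  exists l y' r, line i p x y' r l /\ map (len i) l = cs /\ In K l /\ incl l (concat R).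
Proof.
  revert y R; induction rs as [|r rs IH]; simpl; intros y [|l R]; simpl; try tauto.
  intros (H1 & H2 & H3) HK. apply in_app_or in HK. destruct HK as [HK|HK].
  - exists l, y, r. repeat split; auto. intros M HM; apply in_or_app; auto.
  - destruct (IH _ _ H3 HK) as (l' & y' & r' & A & B & C & D).
    exists l', y', r'. repeat split; auto. intros M HM; apply in_or_app; auto.
Qed.

Lemma rows_above i p x y cs rs R K : rows i p x y cs rs R -> (forall r, In r rs -> 0 < r) ->
  In K (concat R) -> y <= p K (ot i).
Proof.
  revert y R; induction rs as [|r rs IH]; simpl; intros y [|l R]; simpl; try tauto.
  intros (H1 & H2 & H3) Hr HK. apply in_app_or in HK. destruct HK as [HK|HK].
  - rewrite (line_height _ _ _ _ _ _ _ H1 HK). lra.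
  - specialize (IH _ _ H3 (fun r h => Hr r (or_intror h)) HK).
    specialize (Hr r (or_introl eq_refl)). lra.
Qed.

Lemma line_cell i p x y y' h h' l l' K : line i p x y h l -> line i p x y' h' l' ->
  map (len i) l = map (len i) l' -> In K l ->
  exists M, In M l' /\ p M i = p K i /\ len i M = len i K.
Proof.
  revert x l'; induction l as [|L l IH]; simpl; intros x [|L' l']; simpl; try discriminate; try tauto.
  intros (H1 & H2 & H3 & H4) (H1' & H2' & H3' & H4') E [<-|HK]; injection E as E E'.
  - exists L'. repeat split; auto; congruence.
  - rewrite <- E in H4'. destruct (IH _ _ H4 H4' E' HK) as (M & A & B & C). exists M; auto.
Qed.

(** Provides the cell where the column of [K] meets the row of [L], the pivot of the conjugation in
    [grid_swap]. *)
Lemma rows_cell i p x y cs rs R K L : rows i p x y cs rs R -> In K (concat R) -> In L (concat R) ->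
  exists M, In M (concat R) /\ p M i = p K i /\ len i M = len i K /\
    p M (ot i) = p L (ot i) /\ len (ot i) M = len (ot i) L.
Proof.
  intros H HK HL.
  destruct (rows_line _ _ _ _ _ _ _ _ H HK) as (l & y1 & r1 & A1 & B1 & C1 & D1).
  destruct (rows_line _ _ _ _ _ _ _ _ H HL) as (l' & y2 & r2 & A2 & B2 & C2 & D2).
  destruct (line_cell _ _ _ _ _ _ _ _ _ _ A1 A2 (eq_trans B1 (eq_sym B2)) C1) as (M & E & F & G).
  exists M. repeat split; auto.
  - rewrite (line_height _ _ _ _ _ _ _ A2 E), (line_height _ _ _ _ _ _ _ A2 C2). auto.
  - rewrite (line_width _ _ _ _ _ _ _ A2 E), (line_width _ _ _ _ _ _ _ A2 C2). auto.
Qed.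

(** * Transposing rectangles of equal size in a grid *)

Definition transp (K L M : rect) : rect :=
  if rect_eq_dec M K then L else if rect_eq_dec M L then K else M.

Definition same_size (K L : rect) : Prop := forall j, len j K = len j L.

Lemma transp_l K L : transp K L K = L.
Proof. unfold transp. destruct (rect_eq_dec K K); tauto. Qed.

Lemma transp_r K L : transp K L L = K.
Proof.
  unfold transp. destruct (rect_eq_dec L K); auto. destruct (rect_eq_dec L L); tauto.
Qed.

Lemma transp_out K L M : M <> K -> M <> L -> transp K L M = M.
Proof. unfold transp. destruct (rect_eq_dec M K), (rect_eq_dec M L); tauto. Qed.

Lemma transp_inv K L M : transp K L (transp K L M) = M.
Proof.
  destruct (rect_eq_dec M K) as [->|n]; [rewrite transp_l; apply transp_r|].
  destruct (rect_eq_dec M L) as [->|n']; [rewrite transp_r; apply transp_l|].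
  rewrite !(transp_out K L M); auto.
Qed.

Lemma transp_len K L M j : same_size K L -> len j (transp K L M) = len j M.
Proof.
  intros H. destruct (rect_eq_dec M K) as [->|n]; [rewrite transp_l; auto|].
  destruct (rect_eq_dec M L) as [->|n']; [rewrite transp_r; auto|].
  rewrite transp_out; auto.
Qed.

Lemma transp_perm K L l : NoDup l -> In K l -> In L l -> Permutation (map (transp K L) l) l.
Proof.
  intros ND HK HL.
  assert (Hin : forall M, In M l -> In (transp K L M) l).
  { intros M HM. unfold transp. destruct (rect_eq_dec M K), (rect_eq_dec M L); auto. }
  apply NoDup_Permutation; auto.
  - apply FinFun.Injective_map_NoDup; auto.
    intros a b E. rewrite <- (transp_inv K L a), E. apply transp_inv.
  - intros M. rewrite in_map_iff. split.
    + intros (N & <- & HN); auto.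
    + intros HM. exists (transp K L M). split; auto. apply transp_inv.
Qed.

Definition swapped (K L : rect) (p : placement) : placement := fun M => p (transp K L M).

Lemma line_swapped i p x y h l K L : same_size K L -> line i p x y h l ->
  line i (swapped K L p) x y h (map (transp K L) l).
Proof.
  intros E. revert x; induction l as [|M l IH]; simpl; auto.
  intros x (H1 & H2 & H3 & H4). unfold swapped at 1 2. rewrite transp_inv, !transp_len by auto. auto.
Qed.

Lemma rows_swapped i p x y cs rs R K L : same_size K L -> rows i p x y cs rs R ->
  rows i (swapped K L p) x y cs rs (map (map (transp K L)) R).
Proof.
  intros E. revert y R; induction rs as [|r rs IH]; simpl; intros y [|l R]; simpl; auto.
  intros (H1 & H2 & H3). repeat split; auto using line_swapped.
  rewrite map_map, <- H2. apply map_ext. intros; apply transp_len; auto.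
Qed.

(** Positive row extents make heights distinguish rows, so [K] and [L] lie in one row; as their
    sizes agree, the transposition permutes that line. *)
Lemma rows_line_swap i p x y cs rs R K L : rows i p x y cs rs R -> (forall r, In r rs -> 0 < r) ->
  NoDup (concat R) -> incl (concat R) S -> In K (concat R) -> In L (concat R) ->
  same_size K L -> p K (ot i) = p L (ot i) -> conn p (swapped K L p).
Proof.
  revert y R; induction rs as [|r rs IH]; simpl; intros y [|l R]; simpl; try tauto.
  intros (H1 & H2 & H3) Hr ND I HK HL E Ep.
  assert (Hup : forall M, In M (concat R) -> y < p M (ot i)).
  { intros M HM.
    generalize (rows_above _ _ _ _ _ _ _ _ H3 (fun r h => Hr r (or_intror h)) HM).
    specialize (Hr r (or_introl eq_refl)). lra. }
  apply in_app_or in HK, HL. destruct HK as [HK|HK], HL as [HL|HL].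
  - apply line_permute with (i := i) (x := x) (y := y) (h := r) (l := l) (l' := map (transp K L) l); auto.
    + symmetry. apply transp_perm; auto. eapply NoDup_app_remove_r; eauto.
    + eapply NoDup_app_remove_r; eauto.
    + intros M HM; apply I, in_or_app; auto.
    + apply line_swapped; auto.
    + intros M HM j. unfold swapped. rewrite transp_out; auto; intros ->; auto.
  - specialize (Hup _ HL). rewrite (line_height _ _ _ _ _ _ _ H1 HK) in Ep. lra.
  - specialize (Hup _ HK). rewrite (line_height _ _ _ _ _ _ _ H1 HL) in Ep. lra.
  - eapply IH; eauto. eapply NoDup_app_remove_l; eauto. intros M HM; apply I, in_or_app; auto.
Qed.


(** If [K] and [L] share neither row nor column, the crossing cell [M] takes its extents from the
    column of [K] and the row of [L]. It therefore has their common size and can serve as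
    intermediary. *)
Lemma grid_swap i p x y cs rs R K L : rows i p x y cs rs R ->
  (forall r, In r cs -> 0 < r) -> (forall r, In r rs -> 0 < r) ->
  Permutation (concat R) S -> In K S -> In L S -> same_size K L -> conn p (swapped K L p).
Proof.
  intros H Pc Pr HP HK HL E.
  (* Stated for any [q], because swaps are also made at the intermediate placements of the
     conjugation. *)
  assert (row_swap : forall q Q A B, rows i q x y cs rs Q -> Permutation (concat Q) S ->
    In A S -> In B S -> same_size A B -> q A (ot i) = q B (ot i) -> conn q (swapped A B q)).
  { intros q Q A B HQ HQP HA HB EAB Eq. symmetry in HQP.
    eapply rows_line_swap; eauto using Permutation_in.
    - eapply Permutation_NoDup; eauto.
    - intros M HM. eapply Permutation_in; [symmetry; eauto|auto]. }
  assert (col_swap : forall q Q A B, rows i q x y cs rs Q -> Permutation (concat Q) S ->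
    In A S -> In B S -> same_size A B -> q A i = q B i -> conn q (swapped A B q)).
  { intros q Q A B HQ HQP HA HB EAB Eq.
    destruct (rows_transpose _ _ _ _ _ _ _ HQ) as (Q' & HQ' & HP').
    rewrite HQP in HP'. symmetry in HP'.
    eapply rows_line_swap; eauto using Permutation_in.
    - eapply Permutation_NoDup; eauto.
    - intros M HM. eapply Permutation_in; [symmetry; eauto|auto].
    - rewrite ot_ot; auto. }
  assert (sw_grid : forall q Q A B, rows i q x y cs rs Q -> Permutation (concat Q) S ->
    In A S -> In B S -> same_size A B ->
    exists Q', rows i (swapped A B q) x y cs rs Q' /\ Permutation (concat Q') S).
  { intros q Q A B HQ HQP HA HB EAB. exists (map (map (transp A B)) Q).
    split; [apply rows_swapped; auto|]. rewrite <- concat_map, HQP. apply transp_perm; auto. }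
  destruct (Req_EM_T (p K (ot i)) (p L (ot i))) as [e|n]; [eauto|].
  destruct (Req_EM_T (p K i) (p L i)) as [e|n']; [eauto|].
  destruct (rows_cell _ _ _ _ _ _ _ K L H) as (M & HM & M1 & M2 & M3 & M4);
    try (eapply Permutation_in; [symmetry; exact HP|auto]; fail).
  assert (EML : same_size M L).
  { intros j. destruct (coord_cases i j) as [-> | ->]; auto. rewrite M2; auto. }
  assert (EKM : same_size K M) by (intros j; rewrite EML; auto).
  assert (HMS : In M S) by (eapply Permutation_in; eauto).
  assert (nMK : M <> K) by congruence. assert (nML : M <> L) by congruence.
  assert (nKL : K <> L) by congruence.
  destruct (sw_grid p R M L) as (R1 & G1 & P1); auto.
  destruct (sw_grid _ _ K L G1) as (R2 & G2 & P2); auto.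
  (* [M] stands in the row of [L] and in the column of [K]. *)
  apply conn_trans with (swapped M L p); [eapply row_swap; eauto|].
  apply conn_trans with (swapped K L (swapped M L p)).
  { eapply col_swap; eauto. unfold swapped. rewrite transp_r, transp_out; auto. }
  apply conn_trans with (swapped K M (swapped K L (swapped M L p))).
  { eapply row_swap; eauto. unfold swapped. rewrite transp_l, transp_r.
    rewrite (transp_out K L M), transp_l; auto. }
  (* On labels, applying (K M), then (K L), then (M L) amounts to (K L). *)
  apply conn_ext. intros X HX j. unfold swapped. f_equal.
  destruct (rect_eq_dec X K) as [->|nK].
  { rewrite !transp_l, (transp_out K L M), transp_l; auto. }
  destruct (rect_eq_dec X L) as [->|nL].
  { rewrite (transp_out K M L), !transp_r, transp_out; auto. }
  destruct (rect_eq_dec X M) as [->|nM].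
  { rewrite transp_r, transp_l, transp_r, transp_out; auto. }
  rewrite (transp_out K M X), (transp_out K L X), (transp_out M L X); auto.
Qed.

Lemma line_positions i p q x y h l l' : line i p x y h l -> line i q x y h l' ->
  map (len i) l = map (len i) l' ->
  Forall2 (fun K L => (forall j, p K j = q L j) /\ same_size K L) l l'.
Proof.
  revert x l'; induction l as [|K l IH]; simpl; intros x [|K' l']; simpl; try discriminate.
  - constructor.
  - intros (H1 & H2 & H3 & H4) (H1' & H2' & H3' & H4') E; injection E as E E'.
    constructor.
    + split; intros j; destruct (coord_cases i j) as [-> | ->]; congruence.
    + rewrite <- E in H4'. eauto.
Qed.

(** Extents determine every cell, so two grids with the same extents correspond entry by entry in
    the order of [concat]. *)
Lemma rows_positions i p q x y cs rs R R' : rows i p x y cs rs R -> rows i q x y cs rs R' ->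
  Forall2 (fun K L => (forall j, p K j = q L j) /\ same_size K L) (concat R) (concat R').
Proof.
  revert y R R'; induction rs as [|r rs IH]; simpl; intros y [|l R] [|l' R']; simpl; try tauto.
  - constructor.
  - intros (H1 & H2 & H3) (H1' & H2' & H3'). apply Forall2_app; eauto.
    eapply line_positions; eauto. congruence.
Qed.

(** [pre] collects the rectangles already in final position; matching entries of [t1] and [t2] are
    the present and the required occupant of a cell. Each step transposes the two heads, which have
    equal size, so the grid survives. *)
Lemma same_grid_conn_aux i q x y cs rs :
  (forall r, In r cs -> 0 < r) -> (forall r, In r rs -> 0 < r) ->
  forall t2 t1 pre p R, rows i p x y cs rs R -> Permutation (concat R) S ->
  Permutation (pre ++ t1) S -> Permutation t1 t2 ->
  Forall2 (fun K L => (forall j, p K j = q L j) /\ same_size K L) t1 t2 ->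
  (forall K, In K pre -> forall j, p K j = q K j) -> conn p q.
Proof.
  intros Pc Pr. induction t2 as [|L v IH]; intros t1 pre p R H HR Hpre Ht F E.
  - symmetry in Ht. apply Permutation_nil in Ht; subst t1. rewrite app_nil_r in Hpre.
    apply conn_ext. intros K HK; apply E. eapply Permutation_in; [symmetry|]; eauto.
  - inversion F as [|K L' u v' [EK SK] F']; subst.
    assert (ND : NoDup (pre ++ K :: u)) by (eapply Permutation_NoDup; [symmetry|]; eauto).
    assert (HK : In K S).
    { eapply Permutation_in; [eauto|]. apply in_or_app; simpl; auto. }
    assert (HLu : In L (K :: u)) by (eapply Permutation_in; [symmetry; eauto|simpl; auto]).
    assert (HL : In L S).
    { eapply Permutation_in; [eauto|]. apply in_or_app; auto. }
    (* [L] fills the first cell and [K], if different, takes the cell that [L] leaves. *)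
    assert (HT : Permutation (L :: map (transp K L) u) (K :: u)).
    { generalize (transp_perm K L (K :: u) (NoDup_app_remove_l _ _ ND) (or_introl eq_refl) HLu).
      simpl. rewrite transp_l; auto. }
    apply conn_trans with (swapped K L p); [eapply grid_swap; eauto|].
    apply IH with (t1 := map (transp K L) u) (pre := pre ++ [L])
      (R := map (map (transp K L)) R).
    + apply rows_swapped; auto.
    + rewrite <- concat_map, HR. apply transp_perm; auto.
    + rewrite <- Hpre, <- app_assoc. apply Permutation_app_head. exact HT.
    + apply Permutation_cons_inv with L. rewrite <- Ht. exact HT.
    + clear - F' SK. induction F' as [|A B u v [H1 H2] F IH]; simpl; constructor; auto.
      split; [intros j; unfold swapped; rewrite transp_inv; auto|].
      intros j. rewrite transp_len; auto.
    + intros M HM j. unfold swapped. apply in_app_or in HM. destruct HM as [HM|[<-|[]]].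
      * rewrite transp_out; auto; intros ->; eapply NoDup_app_disj; eauto; simpl; auto.
      * rewrite transp_r; auto.
Qed.

Lemma same_grid_conn i p q x y cs rs R R' :
  (forall r, In r cs -> 0 < r) -> (forall r, In r rs -> 0 < r) ->
  rows i p x y cs rs R -> rows i q x y cs rs R' ->
  Permutation (concat R) S -> Permutation (concat R') S -> conn p q.
Proof.
  intros Pc Pr H H' HR HR'.
  apply (same_grid_conn_aux i q x y cs rs Pc Pr (concat R') (concat R) [] p R); auto.
  - now rewrite HR.
  - eapply rows_positions; eauto.
  - simpl; tauto.
Qed.

(** * Blocks *)

(** A block is a rectangular region with lower corner [org], currently tiled by the rectangles
    [labs] as a grid whose lines have the successive extents [dim i] in direction [i]. *)
Record block := Blk { org : coord -> R; dim : coord -> list R; labs : list rect }.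

Definition hi (B : block) (i : coord) : R := org B i + sumR (dim B i).

(** The rows are hidden and [labs] is compared up to order, so that a block can be read along either
    direction, as in [is_grid_any]. *)
Definition is_grid (i : coord) (p : placement) (B : block) : Prop :=
  exists R, rows i p (org B i) (org B (ot i)) (dim B i) (dim B (ot i)) R /\
            Permutation (concat R) (labs B).

(** Extents that are side lengths of rectangles of [S] are positive and subject to [sum_inj]. *)
Definition dim_ok (i : coord) (l : list R) : Prop :=
  l <> [] /\ forall r, In r l -> exists K, In K S /\ r = len i K.

Definition block_ok (B : block) : Prop := forall i, dim_ok i (dim B i).

Lemma is_grid_any i j p B : is_grid i p B -> is_grid j p B.
Proof.
  intros (R & H & HP). destruct (coord_cases i j) as [-> | ->]; [exists R; auto|].
  destruct (rows_transpose _ _ _ _ _ _ _ H) as (R' & H' & HP').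
  exists R'. rewrite ot_ot. split; auto. rewrite HP'; auto.
Qed.

Lemma is_grid_ext i p q B : (forall K, In K (labs B) -> forall j, p K j = q K j) ->
  is_grid i p B -> is_grid i q B.
Proof.
  intros E (R & H & HP). exists R. split; auto. apply (rows_ext i p q); auto.
  intros K HK; apply E. eapply Permutation_in; eauto.
Qed.

Lemma dim_ok_pos i l r : dim_ok i l -> In r l -> 0 < r.
Proof. intros [_ H] Hr. destruct (H r Hr) as (K & HK & ->). apply len_pos; auto. Qed.

Lemma sumR_nonneg l : (forall r, In r l -> 0 < r) -> 0 <= sumR l.
Proof.
  induction l as [|a l IH]; simpl; intros H; [lra|].
  specialize (IH (fun r h => H r (or_intror h))). specialize (H a (or_introl eq_refl)). lra.
Qed.

Lemma dim_ok_sum i l : dim_ok i l -> 0 < sumR l.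
Proof.
  intros D. destruct l as [|a l]; [exfalso; apply (proj1 D); reflexivity|]. simpl.
  assert (0 < a) by (apply (dim_ok_pos i (a :: l)); simpl; auto).
  assert (0 <= sumR l); [|lra].
  apply sumR_nonneg. intros r Hr. apply (dim_ok_pos i (a :: l)); simpl; auto.
Qed.

Lemma grid_reorder i p B l : is_grid i p B -> Permutation (dim B i) l ->
  NoDup (labs B) -> incl (labs B) S ->
  exists q, is_grid i q (Blk (org B) (sel i l (dim B (ot i))) (labs B)) /\ moves_only (labs B) p q.
Proof.
  intros (R & H & HP) Hp ND I. symmetry in HP.
  destruct (rows_reorder _ _ _ _ _ _ _ _ H Hp) as (q & R' & A & B1 & C).
  { eapply Permutation_NoDup; eauto. }
  { intros K HK. apply I. eapply Permutation_in; [symmetry; eauto|auto]. }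
  exists q. split.
  - exists R'. simpl. rewrite sel_same, sel_ot. split; auto. rewrite C; symmetry; auto.
  - eapply moves_only_incl; [|exact B1]. intros K HK. eapply Permutation_in; [symmetry; eauto|auto].
Qed.

(** * Indicator functions and tilings of the square *)

Definition in_ival (a b t : R) : nat :=
  if Rle_dec a t then if Rlt_dec t b then 1%nat else 0%nat else 0%nat.

Lemma in_ival_split a b c t : a <= b <= c -> (in_ival a c t = in_ival a b t + in_ival b c t)%nat.
Proof.
  intros H. unfold in_ival.
  destruct (Rle_dec a t), (Rle_dec b t), (Rlt_dec t c), (Rlt_dec t b); try lra; lia.
Qed.

Lemma in_ival_1 a b t : in_ival a b t = 1%nat <-> a <= t < b.
Proof. unfold in_ival. destruct (Rle_dec a t), (Rlt_dec t b); split; try lra; try lia. Qed.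

Lemma in_ival_01 a b t : in_ival a b t = 0%nat \/ in_ival a b t = 1%nat.
Proof. unfold in_ival. destruct (Rle_dec a t), (Rlt_dec t b); auto. Qed.

Definition ind (B : block) (x : coord -> R) : nat :=
  (in_ival (org B C1) (hi B C1) (x C1) * in_ival (org B C2) (hi B C2) (x C2))%nat.

Definition inside (B : block) (x : coord -> R) : Prop := forall i, org B i <= x i < hi B i.

Lemma ind_dir i B x :
  ind B x = (in_ival (org B i) (hi B i) (x i) * in_ival (org B (ot i)) (hi B (ot i)) (x (ot i)))%nat.
Proof. destruct i; unfold ind; simpl; lia. Qed.

Lemma ind_inside B x : inside B x <-> ind B x = 1%nat.
Proof.
  unfold ind, inside. split.
  - intros H. generalize (H C1) (H C2). rewrite <- !in_ival_1. intros -> ->; auto.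
  - intros H. apply Nat.mul_eq_1 in H. rewrite !in_ival_1 in H. intros []; tauto.
Qed.

Definition cnt (Bs : list block) (x : coord -> R) : nat := list_sum (map (fun B => ind B x) Bs).

Definition in_unit_ind (x : coord -> R) : nat := (in_ival 0 1 (x C1) * in_ival 0 1 (x C2))%nat.

(** Equality of indicators says at once that the blocks lie in the square, cover it and are
    disjoint; being additive, it reduces cutting and gluing to arithmetic. *)
Definition tiles_unit (Bs : list block) : Prop := forall x, cnt Bs x = in_unit_ind x.

Lemma cnt_app Bs Bs' x : cnt (Bs ++ Bs') x = (cnt Bs x + cnt Bs' x)%nat.
Proof. unfold cnt. rewrite map_app. apply list_sum_app. Qed.

Lemma cnt_perm Bs Bs' x : Permutation Bs Bs' -> cnt Bs x = cnt Bs' x.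
Proof. unfold cnt. induction 1; simpl; lia. Qed.

Lemma cnt_in B Bs x : In B Bs -> inside B x -> (1 <= cnt Bs x)%nat.
Proof.
  rewrite ind_inside. unfold cnt. induction Bs as [|A Bs IH]; simpl; [tauto|].
  intros [->|H] E; [lia|]. specialize (IH H E). lia.
Qed.

Lemma cnt_ex Bs x : (1 <= cnt Bs x)%nat -> exists B, In B Bs /\ inside B x.
Proof.
  unfold cnt. induction Bs as [|A Bs IH]; simpl; [lia|]. intros H.
  destruct (Nat.eq_dec (ind A x) 1) as [e|n]; [exists A; rewrite ind_inside; auto|].
  assert (ind A x = 0)%nat.
  { unfold ind in *. destruct (in_ival_01 (org A C1) (hi A C1) (x C1)) as [e|e], (in_ival_01 (org A C2) (hi A C2) (x C2)) as [e'|e']; rewrite e, e' in *; lia. }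
  destruct IH as (B & H1 & H2); [lia|]. exists B; auto.
Qed.

Lemma in_unit_ind_1 x : in_unit_ind x = 1%nat <-> forall i, 0 <= x i < 1.
Proof.
  unfold in_unit_ind. split.
  - intros H. apply Nat.mul_eq_1 in H. rewrite !in_ival_1 in H. intros []; tauto.
  - intros H. generalize (H C1) (H C2). rewrite <- !in_ival_1. intros -> ->; auto.
Qed.

Lemma in_unit_ind_le x : (in_unit_ind x <= 1)%nat.
Proof.
  unfold in_unit_ind.
  destruct (in_ival_01 0 1 (x C1)) as [->| ->], (in_ival_01 0 1 (x C2)) as [->| ->]; lia.
Qed.

Lemma tiles_in_unit Bs B x : tiles_unit Bs -> In B Bs -> inside B x -> forall i, 0 <= x i < 1.
Proof.
  intros T HB HI. apply in_unit_ind_1. generalize (cnt_in _ _ _ HB HI) (in_unit_ind_le x).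
  rewrite (T x). lia.
Qed.

Lemma tiles_ex Bs x : tiles_unit Bs -> (forall i, 0 <= x i < 1) -> exists B, In B Bs /\ inside B x.
Proof. intros T H. apply cnt_ex. rewrite (T x). apply in_unit_ind_1 in H. lia. Qed.

Lemma tiles_disjoint Bs Bs' A B x : tiles_unit (Bs ++ Bs') -> In A Bs -> In B Bs' ->
  inside A x -> inside B x -> False.
Proof.
  intros T HA HB IA IB. generalize (cnt_in _ _ _ HA IA) (cnt_in _ _ _ HB IB) (in_unit_ind_le x).
  rewrite <- (T x), cnt_app. lia.
Qed.

Lemma block_ok_hi B i : block_ok B -> org B i < hi B i.
Proof. intros H. generalize (dim_ok_sum _ _ (H i)). unfold hi. lra. Qed.

Lemma inside_org B : block_ok B -> inside B (org B).
Proof. intros H i. generalize (block_ok_hi B i H). lra. Qed.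

Lemma tiles_org Bs B i : tiles_unit Bs -> In B Bs -> block_ok B -> 0 <= org B i.
Proof. intros T HB H. eapply tiles_in_unit; eauto using inside_org. Qed.

Lemma tiles_hi Bs B i : tiles_unit Bs -> In B Bs -> block_ok B -> hi B i <= 1.
Proof.
  intros T HB H. destruct (Rle_lt_dec (hi B i) 1) as [l|l]; auto. exfalso.
  (* If [B] stuck out, it would contain a point whose coordinate [i] is at least 1; the maximum
     gives one. *)
  assert (E : inside B (sel i (Rmax (org B i) 1) (org B (ot i)))).
  { intros j. destruct (coord_cases i j) as [-> | ->]; rewrite ?sel_same, ?sel_ot.
    - split; [apply Rmax_l|]. apply Rmax_lub_lt; auto using block_ok_hi.
    - generalize (block_ok_hi B (ot i) H). lra. }
  generalize (tiles_in_unit _ _ _ T HB E i). rewrite sel_same.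
  generalize (Rmax_r (org B i) 1). lra.
Qed.

Lemma inside_sel B i a b : org B i <= a < hi B i -> org B (ot i) <= b < hi B (ot i) ->
  inside B (sel i a b).
Proof.
  intros H1 H2 j. destruct (coord_cases i j) as [-> | ->]; rewrite ?sel_same, ?sel_ot; auto.
Qed.

Lemma inside_sel_inv B i a b : inside B (sel i a b) ->
  org B i <= a < hi B i /\ org B (ot i) <= b < hi B (ot i).
Proof. intros H. generalize (H i) (H (ot i)). rewrite sel_same, sel_ot. auto. Qed.

(** * Neighbours across a side of the corner block *)

Fixpoint stacked (i : coord) (a y b : R) (Rs : list block) : Prop :=
  match Rs with
  | [] => y = b
  | B :: Rs' => org B i = a /\ org B (ot i) = y /\ stacked i a (hi B (ot i)) b Rs'
  end.

(** Climbs the line where coordinate [i] equals [a], from height [y] to [b], always taking the block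
    that contains the current point. [used] holds the blocks passed so far: they cover the line
    below [y] and avoid it from [y] on. *)
Lemma stacked_ex_aux i a b : 0 <= a < 1 -> b <= 1 ->
  forall n Bs used y, length Bs = n -> tiles_unit (used ++ Bs) ->
  (forall B, In B Bs -> block_ok B) -> 0 <= y <= b ->
  (forall t, 0 <= t < y -> exists U, In U used /\ inside U (sel i a t)) ->
  (forall U t, In U used -> y <= t -> ~ inside U (sel i a t)) ->
  (forall B, In B Bs -> org B i = a -> org B (ot i) < b -> hi B (ot i) <= b) ->
  (forall B t, In B Bs -> inside B (sel i a t) -> t < b -> org B i = a) ->
  exists Rs others, Permutation Bs (Rs ++ others) /\ stacked i a y b Rs.
Proof.
  intros Ha Hb. induction n as [|n IH]; intros Bs used y Hn T ok Hy Hcov Hfree Hgood Hleft;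
    (destruct (Req_EM_T y b) as [->|ne]; [exists [], Bs; simpl; auto|]).
  all: destruct (tiles_ex _ (sel i a y) T) as (B & HB & IB);
    [intros j; destruct (coord_cases i j) as [-> | ->]; rewrite ?sel_same, ?sel_ot; lra|].
  all: apply in_app_or in HB; destruct HB as [HB|HB]; [exfalso; eapply Hfree; eauto; lra|].
  { destruct Bs; simpl in *; [tauto|discriminate]. }
  assert (EB : org B i = a) by (eapply Hleft; eauto; lra).
  destruct (inside_sel_inv _ _ _ _ IB) as [I1 I2].
  assert (Eo : org B (ot i) = y).
  (* If [B] started lower, it would meet a used block at the height where it starts. *)
  { destruct (Req_EM_T (org B (ot i)) y) as [e|e]; auto. exfalso.
    assert (0 <= org B (ot i)).
    { eapply tiles_org; eauto. apply in_or_app; auto. }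
    destruct (Hcov (org B (ot i))) as (U & HU & IU); [lra|].
    eapply tiles_disjoint; eauto. apply inside_sel; lra. }
  assert (Hh : hi B (ot i) <= b) by (apply Hgood; auto; lra).
  destruct (in_split _ _ HB) as (l1 & l2 & ->).
  assert (HP : Permutation (l1 ++ B :: l2) (B :: l1 ++ l2)).
  { symmetry. apply Permutation_middle. }
  assert (sub : forall A, In A (l1 ++ l2) -> In A (l1 ++ B :: l2)).
  { intros A HA. eapply Permutation_in; [symmetry; exact HP|simpl; auto]. }
  destruct (IH (l1 ++ l2) (B :: used) (hi B (ot i))) as (Rs & others & P1 & P2).
  - apply Permutation_length in HP. simpl in HP. lia.
  - intros x. rewrite <- (T x). apply cnt_perm. simpl. rewrite HP. apply Permutation_middle.
  - auto.
  - lra.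
  - intros t Ht. destruct (Rlt_le_dec t y) as [l|l].
    + destruct (Hcov t) as (U & HU & IU); [lra|]. exists U; simpl; auto.
    + exists B. split; simpl; auto. apply inside_sel; lra.
  - intros U t [<-|HU] Ht IU.
    + apply inside_sel_inv in IU. lra.
    + eapply Hfree; eauto. lra.
  - auto.
  - intros A t HA; eauto.
  - exists (B :: Rs), others. simpl. rewrite HP, P1. auto.
Qed.

(** Only the upper end of the side is constrained: this is meant for a block at the origin, where no
    neighbour can protrude at the lower end. *)
Definition side_fits (i : coord) (T : block) (Bs : list block) : Prop :=
  hi T i < 1 /\
  forall B, In B Bs -> org B i = hi T i -> org B (ot i) < hi T (ot i) -> hi B (ot i) <= hi T (ot i).

Lemma stacked_ex i T Bs : tiles_unit (T :: Bs) -> (forall B, In B (T :: Bs) -> block_ok B) ->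
  (forall j, org T j = 0) -> side_fits i T Bs ->
  exists Rs others, Permutation Bs (Rs ++ others) /\ stacked i (hi T i) (org T (ot i)) (hi T (ot i)) Rs.
Proof.
  intros HT ok OT [H1 H2].
  assert (P : forall j, 0 < hi T j).
  { intros j. rewrite <- (OT j). apply block_ok_hi, ok; simpl; auto. }
  assert (okB : forall B, In B Bs -> block_ok B) by (intros; apply ok; simpl; auto).
  generalize (P i) (P (ot i)); intros P1 P2. rewrite OT.
  apply stacked_ex_aux with (n := length Bs) (used := [T]); auto; try lra.
  - eapply tiles_hi; eauto; [simpl; auto|apply ok; simpl; auto].
  - intros t Ht. lra.
  - intros U t [<-|[]] Ht IU. apply inside_sel_inv in IU. lra.
  (* A block straddling the line of this side would reach back into [T]. *)
  - intros B t HB IB Ht. destruct (inside_sel_inv _ _ _ _ IB) as [I1 I2].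
    destruct (Req_EM_T (org B i) (hi T i)) as [e|e]; auto. exfalso.
    assert (G : forall j, 0 <= org B j) by (intros j; eapply tiles_org; eauto; simpl; auto).
    generalize (G i) (G (ot i)); intros G1 G2.
    apply (tiles_disjoint [T] Bs T B (sel i (org B i) t)); simpl; auto.
    + apply inside_sel; rewrite OT; lra.
    + apply inside_sel; lra.
Qed.

(** Two blocks overlapping the two free sides at the upper corner of [T] would both contain it. *)
Lemma corner_side_fits T B0 Bs : tiles_unit (T :: B0 :: Bs) ->
  (forall B, In B (T :: B0 :: Bs) -> block_ok B) ->
  (forall j, org T j = 0) -> exists i, side_fits i T (B0 :: Bs).
Proof.
  intros HT ok OT.
  assert (Hle : forall j B, In B (T :: B0 :: Bs) -> hi B j <= 1).
  { intros j B HB. eapply tiles_hi; eauto. }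
  assert (P : forall j, 0 < hi T j).
  { intros j. rewrite <- (OT j). apply block_ok_hi, ok; simpl; auto. }
  assert (fit1 : forall j, hi T (ot j) = 1 -> hi T j < 1 -> side_fits j T (B0 :: Bs)).
  { intros j E1 E2. split; auto. intros B HB _ _. rewrite E1. apply Hle. simpl in *; auto. }
  assert (T1 : hi T C1 <= 1) by (apply Hle; simpl; auto).
  assert (T2 : hi T C2 <= 1) by (apply Hle; simpl; auto).
  destruct (Rlt_le_dec (hi T C1) 1) as [l1|l1], (Rlt_le_dec (hi T C2) 1) as [l2|l2].
  (* If [T] reaches the boundary in just one direction, its free side spans the square and nothing
     protrudes. *)
  2: { exists C1. apply fit1; simpl; lra. }
  2: { exists C2. apply fit1; simpl; lra. }
  (* Here [T] would fill the whole square and overlap [B0]. *)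
  2: { exfalso. assert (ok0 : block_ok B0) by (apply ok; simpl; auto).
    assert (G : forall j, 0 <= org B0 j).
    { intros j; eapply tiles_org; eauto; simpl; auto. }
    apply (tiles_disjoint [T] (B0 :: Bs) T B0 (org B0)); simpl; auto using inside_org.
    intros j. rewrite OT. split; auto.
    generalize (tiles_in_unit _ _ _ HT (or_intror (or_introl eq_refl)) (inside_org _ ok0) j).
    destruct j; lra. }
  destruct (Classical_Prop.classic (side_fits C1 T (B0 :: Bs))) as [F|F]; [eauto|].
  exists C2. split; auto. intros B HB E1 E2. simpl in E2 |- *.
  destruct (Rle_lt_dec (hi B C1) (hi T C1)) as [l|l]; auto. exfalso. apply F.
  split; auto. intros B' HB' E1' E2'. simpl in E2' |- *.
  destruct (Rle_lt_dec (hi B' C2) (hi T C2)) as [l'|l']; auto. exfalso.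
  assert (okB : block_ok B) by (apply ok; simpl in *; auto).
  assert (okB' : block_ok B') by (apply ok; simpl in *; auto).
  generalize (block_ok_hi B C2 okB) (block_ok_hi B' C1 okB'); intros Q1 Q2.
  assert (I1 : inside B (hi T)) by (intros []; lra).
  assert (I2 : inside B' (hi T)) by (intros []; lra).
  destruct (in_split _ _ HB) as (u1 & u2 & Eu).
  assert (HP : Permutation (T :: B0 :: Bs) ([B] ++ T :: u1 ++ u2)).
  { rewrite Eu. rewrite <- Permutation_middle. apply perm_swap. }
  assert (B' = B \/ In B' (T :: u1 ++ u2)) as [->|Hin].
  { assert (X : In B' ([B] ++ T :: u1 ++ u2)) by (eapply Permutation_in; [exact HP|simpl in *; auto]).
    simpl in X |- *. intuition. }
  - lra.
  - eapply (tiles_disjoint [B] (T :: u1 ++ u2) B B' (hi T)); simpl; auto.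
    intros x. rewrite <- (HT x). symmetry. apply cnt_perm; exact HP.
Qed.

(** Induction along the neighbours: cut from [T] the lines matching the first neighbour [B], glue
    them to [B], and go on with the remainder of [T]. Only [dim T i] is asked to be [dim_ok], as the
    remainder finally has no lines. *)
Lemma merge_stack i p : forall Rs T b, is_grid i p T -> dim_ok i (dim T i) ->
  (forall B, In B Rs -> is_grid i p B /\ block_ok B) ->
  dim T (ot i) = flat_map (fun B => dim B (ot i)) Rs ->
  stacked i (hi T i) (org T (ot i)) b Rs ->
  exists Ms, length Ms = length Rs /\ (forall M, In M Ms -> is_grid i p M /\ block_ok M) /\
    Permutation (flat_map labs Ms) (labs T ++ flat_map labs Rs) /\
    forall x, cnt Ms x = (ind T x + cnt Rs x)%nat.
Proof.
  induction Rs as [|B Rs IH]; intros T b (R & HR & HP) DT HRs ED St.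
  (* The remainder has zero transversal extent, so its indicator vanishes. *)
  - exists []. simpl in *. rewrite ED in HR. destruct R; [|destruct HR]. simpl in HP.
    apply Permutation_nil in HP. rewrite HP. repeat split; auto; try tauto.
    intros x. unfold cnt. simpl. rewrite (ind_dir i). unfold hi. rewrite ED. simpl.
    rewrite Rplus_0_r. unfold in_ival at 2.
    destruct (Rle_dec (org T (ot i)) (x (ot i))), (Rlt_dec (x (ot i)) (org T (ot i))); try lra; lia.
  - simpl in St, ED. destruct St as (S1 & S2 & St).
    rewrite ED in HR. destruct (rows_app _ _ _ _ _ _ _ _ HR) as (R1 & R2 & -> & HR1 & HR2).
    destruct (HRs B (or_introl eq_refl)) as [(RB & HB & HPB) okB].
    rewrite S1, S2 in HB.
    destruct (rows_join _ _ _ _ _ _ _ _ _ HR1 HB) as (R3 & H3 & HP3).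
    assert (DR : dim_ok (ot i) (dim B (ot i))) by apply okB.
    assert (hiB : hi B (ot i) = org T (ot i) + sumR (dim B (ot i))) by (unfold hi; congruence).
    (* The remainder of [T] beyond the cut. *)
    set (T' := Blk (sel i (org T i) (hi B (ot i)))
      (sel i (dim T i) (flat_map (fun B => dim B (ot i)) Rs)) (concat R2)).
    assert (T'i : org T' i = org T i) by apply sel_same.
    assert (T'o : org T' (ot i) = hi B (ot i)) by apply sel_ot.
    assert (T'd : dim T' i = dim T i) by apply sel_same.
    assert (T'e : dim T' (ot i) = flat_map (fun B => dim B (ot i)) Rs) by apply sel_ot.
    destruct (IH T' b) as (Ms & L & M1 & M2 & M3).
    { exists R2. rewrite T'i, T'o, T'd, T'e, hiB. simpl. auto. }
    { rewrite T'd; auto. }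
    { intros; apply HRs; simpl; auto. }
    { exact T'e. }
    { unfold hi at 1. rewrite T'i, T'o, T'd. exact St. }
    (* [B] extended backwards by the piece cut from [T]. *)
    set (M := Blk (org T) (sel i (dim T i ++ dim B i) (dim B (ot i))) (concat R1 ++ labs B)).
    assert (Md : dim M i = dim T i ++ dim B i) by apply sel_same.
    assert (Me : dim M (ot i) = dim B (ot i)) by apply sel_ot.
    exists (M :: Ms). split; [simpl; auto|split; [|split]].
    + intros A [<-|HA]; auto. split.
      * exists R3. rewrite Md, Me. simpl. split; auto. rewrite HP3, HPB. auto.
      * intros j. destruct (coord_cases i j) as [-> | ->]; rewrite ?Md, ?Me; auto.
        destruct DT as [D1 D2], (okB i) as [D3 D4]. split.
        -- intros E. apply app_eq_nil in E. tauto.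
        -- intros r Hr. apply in_app_or in Hr. destruct Hr; auto.
    + simpl. rewrite M2, <- HP, concat_app. simpl. rewrite <- !app_assoc.
      apply Permutation_app_head. rewrite !app_assoc. apply Permutation_app_tail, Permutation_app_comm.
    (* [M] splits where it meets [B], and [T] splits at the cut; both sides then count the cut
       piece, [T'] and [B] once. *)
    + intros x. unfold cnt in *. simpl. rewrite M3. rewrite !(ind_dir i).
      unfold hi. rewrite Md, Me, T'i, T'o, T'd, T'e, ED, S1, S2, !sumR_app. simpl.
      rewrite hiB. unfold hi at 1 2.
      assert (P1 := dim_ok_sum _ _ DT). assert (P2 := dim_ok_sum _ _ (okB i)).
      assert (P3 := dim_ok_sum _ _ DR).
      assert (P4 : 0 <= sumR (flat_map (fun B => dim B (ot i)) Rs)).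
      { apply sumR_nonneg. intros r Hr. apply in_flat_map in Hr. destruct Hr as (A & HA & Hr).
        eapply dim_ok_pos; [|exact Hr]. apply HRs; simpl; auto. }
      rewrite (in_ival_split (org T i) (org T i + sumR (dim T i))) by lra.
      rewrite (in_ival_split (org T (ot i)) (org T (ot i) + sumR (dim B (ot i)))
        (org T (ot i) + (sumR (dim B (ot i)) + _))) by lra.
      rewrite !Rplus_assoc. lia.
Qed.

(** The only consequence of setwise Q-freeness that is needed. *)
Hypothesis sum_inj : forall i l l',
  (forall r, In r l -> exists K, In K S /\ r = len i K) ->
  (forall r, In r l' -> exists K, In K S /\ r = len i K) ->
  sumR l = sumR l' -> Permutation l l'.

Definition config (p : placement) (Bs : list block) : Prop :=
  (forall B, In B Bs -> is_grid C1 p B /\ block_ok B) /\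
  Permutation (flat_map labs Bs) S /\ tiles_unit Bs.

Lemma config_perm p Bs Bs' : Permutation Bs Bs' -> config p Bs -> config p Bs'.
Proof.
  intros HP (H1 & H2 & H3). split; [|split].
  - intros B HB. apply H1. eapply Permutation_in; [symmetry|]; eauto.
  - rewrite <- H2. symmetry. apply Permutation_flat_map; auto.
  - intros x. rewrite <- (H3 x). symmetry. apply cnt_perm; auto.
Qed.

Lemma stacked_hi i a Rs y b : stacked i a y b Rs ->
  y + sumR (flat_map (fun B => dim B (ot i)) Rs) = b.
Proof.
  revert y; induction Rs as [|B Rs IH]; simpl; intros y; [lra|].
  intros (H1 & H2 & H3). apply IH in H3. unfold hi in H3. rewrite sumR_app. lra.
Qed.

(** The block at the origin is distributed over its neighbours across one side and disappears. *)
Lemma config_merge p B1 B2 Bs : config p (B1 :: B2 :: Bs) ->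
  exists q Bs', conn p q /\ config q Bs' /\ length Bs' = length (B2 :: Bs).
Proof.
  intros HC0.
  destruct (tiles_ex _ (fun _ => 0) (proj2 (proj2 HC0))) as (T & HT & IT); [intros; lra|].
  assert (exists B3 Bs', Permutation (B1 :: B2 :: Bs) (T :: B3 :: Bs')) as (B3 & Bs' & HP).
  { destruct (in_split _ _ HT) as (u1 & u2 & E).
    destruct (u1 ++ u2) as [|B3 Bs'] eqn:E'.
    - apply app_eq_nil in E'. destruct E' as [-> ->]. discriminate.
    - exists B3, Bs'. rewrite E, <- E'. symmetry. apply Permutation_middle. }
  assert (HC := config_perm _ _ _ HP HC0).
  apply Permutation_length in HP. injection HP as HP.
  change (length (B2 :: Bs)) with (Datatypes.S (length Bs)). rewrite HP.
  clear - S_ok S_nodup sum_inj HC IT.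
  destruct HC as (H1 & H2 & H3).
  assert (ok : forall B, In B (T :: B3 :: Bs') -> block_ok B) by (intros; apply H1; auto).
  assert (OT : forall j, org T j = 0).
  { intros j. generalize (IT j) (tiles_org _ _ j H3 (or_introl eq_refl) (ok T (or_introl eq_refl))).
    lra. }
  destruct (corner_side_fits _ _ _ H3 ok OT) as (i & F).
  destruct (stacked_ex i _ _ H3 ok OT F) as (Rs & others & P1 & St).
  assert (Hall : forall B, In B (T :: Rs ++ others) -> is_grid C1 p B /\ block_ok B).
  { intros B [<-|HB]; [apply H1; simpl; auto|].
    apply H1. right. eapply Permutation_in; [symmetry|]; eauto. }
  assert (HRs : forall B, In B Rs -> is_grid C1 p B /\ block_ok B).
  { intros; apply Hall; simpl; right; apply in_or_app; auto. }
  assert (PL : Permutation (labs T ++ flat_map labs Rs ++ flat_map labs others) S).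
  { assert (X := Permutation_flat_map labs (perm_skip T P1)). simpl in X.
    rewrite flat_map_app in X. rewrite <- X. exact H2. }
  assert (ND : NoDup (labs T ++ flat_map labs Rs ++ flat_map labs others)).
  { eapply Permutation_NoDup; [symmetry|]; eauto. }
  (* The side of [T] and the stack of neighbours have equal total length, so their extents agree up
     to order. *)
  assert (Pd : Permutation (dim T (ot i)) (flat_map (fun B => dim B (ot i)) Rs)).
  { apply (sum_inj (ot i)).
    - apply (ok T (or_introl eq_refl) (ot i)).
    - intros r Hr. apply in_flat_map in Hr. destruct Hr as (B & HB & Hr).
      destruct (HRs B HB) as [_ okB]. destruct (okB (ot i)) as [_ D]. auto.
    - apply stacked_hi in St. unfold hi in St. lra. }
  destruct (grid_reorder (ot i) p T _ (is_grid_any _ _ _ _ (proj1 (Hall T (or_introl eq_refl)))) Pd)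
    as (q & G & [M1 M2]).
  { eapply NoDup_app_remove_r; eauto. }
  { intros K HK. eapply Permutation_in; [exact PL|]. apply in_or_app; auto. }
  rewrite ot_ot in G.
  set (T' := Blk _ _ _) in G.
  assert (T'd : dim T' i = dim T i).
  { clear. now destruct i. }
  assert (T'e : dim T' (ot i) = flat_map (fun B => dim B (ot i)) Rs) by apply sel_same.
  assert (Gext : forall B, In B (Rs ++ others) -> is_grid C1 q B).
  { intros B HB. eapply is_grid_ext; [|apply (Hall B); simpl; auto].
    intros K HK j. apply M2. intros HK'. eapply NoDup_app_disj; eauto.
    rewrite <- flat_map_app. apply in_flat_map. eauto. }
  assert (HhT : forall j, hi T' j = hi T j).
  { intros j. unfold hi. destruct (coord_cases i j) as [-> | ->].
    - rewrite T'd; auto.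
    - rewrite T'e, <- (sumR_perm _ _ Pd). auto. }
  destruct (merge_stack i q Rs T' (hi T (ot i))) as (Ms & L & A1 & A2 & A3).
  - eapply is_grid_any; eauto.
  - rewrite T'd. apply (ok T); simpl; auto.
  - intros B HB. split; [|apply HRs; auto].
    apply is_grid_any with C1. apply Gext, in_or_app; auto.
  - exact T'e.
  - rewrite HhT. exact St.
  - exists q, (Ms ++ others). split; [auto|]. split; [split; [|split]|].
    + intros B HB. apply in_app_or in HB. destruct HB as [HB|HB].
      * destruct (A1 B HB) as [X Y]. split; auto. eapply is_grid_any; eauto.
      * split; [apply Gext, in_or_app; auto|]. apply Hall. right. apply in_or_app; auto.
    + rewrite flat_map_app, A2, <- PL, <- app_assoc. auto.
    + intros x. rewrite <- (H3 x), (cnt_perm _ _ x (perm_skip T P1)).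
      change (T :: Rs ++ others) with ([T] ++ Rs ++ others). rewrite !cnt_app, A3.
      (* Permuting lines leaves the region of [T] unchanged. *)
      assert (E : ind T' x = cnt [T] x).
      { unfold cnt; simpl. unfold ind. rewrite !HhT. simpl. lia. }
      lia.
    + rewrite length_app, L. apply Permutation_length in P1. rewrite length_app in P1.
      simpl in P1. lia.
Qed.

Lemma config_single p Bs : config p Bs -> exists q B, conn p q /\ config q [B].
Proof.
  remember (length Bs) as n eqn:Hn. revert p Bs Hn.
  induction n as [n IH] using (well_founded_induction Nat.lt_wf_0). intros p Bs Hn HC.
  destruct Bs as [|B [|B' Bs]].
  - exfalso. destruct (tiles_ex _ (fun _ => 0) (proj2 (proj2 HC))) as (B & [] & _). intros; lra.
  - exists p, B. split; auto. apply conn_refl.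
  - destruct (config_merge _ _ _ _ HC) as (q & Bs' & C & HC' & L).
    destruct (IH (length Bs')) with (p := q) (Bs := Bs') as (q' & B0 & C' & HC''); auto.
    { simpl in *. lia. }
    exists q', B0. split; auto. eapply conn_trans; eauto.
Qed.

Lemma single_unit p B : config p [B] -> forall i, org B i = 0 /\ sumR (dim B i) = 1.
Proof.
  intros (H1 & _ & H3) i.
  assert (okB : block_ok B) by (apply H1; simpl; auto).
  assert (Hin : forall x, (forall j, 0 <= x j < 1) -> inside B x).
  { intros x Hx. destruct (tiles_ex _ x H3 Hx) as (B' & [<-|[]] & I). auto. }
  assert (O : 0 <= org B i) by (eapply tiles_org; eauto; simpl; auto).
  assert (Hh : hi B i <= 1) by (eapply tiles_hi; eauto; simpl; auto).
  generalize (Hin (fun _ => 0) (fun _ => ltac:(lra)) i); intros I0. simpl in I0.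
  assert (O' : org B i = 0) by lra. split; auto.
  destruct (Rlt_le_dec (hi B i) 1) as [l|l]; [|unfold hi in *; lra]. exfalso.
  (* This point of the square would not lie in [B]. *)
  generalize (Hin (fun _ => hi B i) (fun _ => ltac:(lra)) i). lra.
Qed.

Definition unit_block (p : placement) (K : rect) : block := Blk (p K) (fun i => [len i K]) [K].

Lemma config_init p : tiles_unit (map (unit_block p) S) -> config p (map (unit_block p) S).
Proof.
  intros T. split; [|split; auto].
  - intros B HB. apply in_map_iff in HB. destruct HB as (K & <- & HK). split.
    + exists [[K]]. simpl. auto 6.
    + intros i. split; [discriminate|]. simpl. intros r [<-|[]]. eauto.
  - clear. induction S; simpl; auto.
Qed.

Theorem tilings_conn p q : tiles_unit (map (unit_block p) S) -> tiles_unit (map (unit_block q) S) ->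
  conn p q.
Proof.
  intros Tp Tq.
  destruct (config_single _ _ (config_init _ Tp)) as (p1 & B & Cp & HB).
  destruct (config_single _ _ (config_init _ Tq)) as (q1 & B' & Cq & HB').
  assert (U := single_unit _ _ HB). assert (U' := single_unit _ _ HB').
  destruct HB as (G & PB & _), HB' as (G' & PB' & _).
  destruct (G B (or_introl eq_refl)) as [Gp okp], (G' B' (or_introl eq_refl)) as [Gq okq].
  simpl in PB, PB'. rewrite app_nil_r in PB, PB'.
  assert (Pd : forall i, Permutation (dim B' i) (dim B i)).
  { intros i. apply (sum_inj i); [apply okq|apply okp|]. destruct (U i), (U' i). lra. }
  assert (ND : NoDup (labs B')) by (eapply Permutation_NoDup; [symmetry|]; eauto).
  assert (I : incl (labs B') S) by (intros K HK; eapply Permutation_in; eauto).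
  (* The second grid is given the column and row order of the first; afterwards both have identical
     extents. *)
  destruct (grid_reorder C1 q1 B' _ Gq (Pd C1) ND I) as (q2 & G2 & [Cq2 _]).
  destruct (grid_reorder C2 q2 _ _ (is_grid_any _ _ _ _ G2) (Pd C2) ND I) as (q3 & G3 & [Cq3 _]).
  simpl in G3. apply (is_grid_any _ C1) in G3.
  destruct Gp as (Rp & HRp & PRp), G3 as (Rq & HRq & PRq). simpl in HRp, HRq, PRq.
  rewrite (proj1 (U C1)), (proj1 (U C2)) in HRp. rewrite (proj1 (U' C1)), (proj1 (U' C2)) in HRq.
  assert (C : conn p1 q3).
  { eapply (same_grid_conn C1); [| |exact HRp|exact HRq| |].
    - intros r Hr. eapply dim_ok_pos; [apply okp|exact Hr].
    - intros r Hr. eapply dim_ok_pos; [apply okp|exact Hr].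
    - rewrite PRp; auto.
    - rewrite PRq; auto. }
  eapply conn_trans; [exact Cp|]. eapply conn_trans; [exact C|].
  apply conn_sym. eapply conn_trans; [exact Cq|]. eapply conn_trans; eauto.
Qed.

End Placements.

(** * Independence, tilings and shuffles *)

(** Collects repeated lengths into multiplicities, because [Q_lin_indep] speaks of duplicate-free
    lists. *)
Lemma sum_count_occ N l : NoDup N -> incl l N ->
  sumR (map (fun r => INR (count_occ Req_EM_T l r) * r) N) = sumR l.
Proof.
  intros ND. induction l as [|a l IH]; intros I.
  - clear. induction N; simpl in *; lra.
  - change (sumR (a :: l)) with (a + sumR l). rewrite <- IH by (intros r Hr; apply I; simpl; auto).
    assert (Ha : In a N) by (apply I; simpl; auto).
    destruct (in_split _ _ Ha) as (N1 & N2 & ->).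
    assert (E : forall M, ~ In a M ->
      map (fun r => INR (count_occ Req_EM_T (a :: l) r) * r) M =
      map (fun r => INR (count_occ Req_EM_T l r) * r) M).
    { intros M HM. apply map_ext_in. intros r Hr. rewrite count_occ_cons_neq; auto.
      intros ->; auto. }
    apply NoDup_remove_2 in ND. rewrite in_app_iff in ND.
    rewrite !map_app, !sumR_app. cbn [map].
    rewrite !E by tauto. rewrite count_occ_cons_eq, S_INR by auto. simpl. lra.
Qed.

(** The differences of multiplicities are the coefficients of a vanishing combination over the
    common support, hence zero. *)
Lemma Q_lin_indep_sum_inj (X : R -> Prop) l l' : Q_lin_indep X ->
  (forall r, In r l -> X r) -> (forall r, In r l' -> X r) ->
  sumR l = sumR l' -> Permutation l l'.
Proof.
  intros HX Hl Hl' E. apply (Permutation_count_occ Req_EM_T). intros r.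
  set (N := nodup Req_EM_T (l ++ l')).
  assert (ND : NoDup N) by apply NoDup_nodup.
  assert (HN : forall r, In r N <-> In r l \/ In r l').
  { intros t. unfold N. rewrite nodup_In. apply in_app_iff. }
  set (c := fun t : R => inject_Z (Z.of_nat (count_occ Req_EM_T l t) - Z.of_nat (count_occ Req_EM_T l' t))).
  assert (H0 : fold_right (fun p acc => Q2R (snd p) * fst p + acc) 0 (map (fun t => (t, c t)) N) = 0).
  { rewrite <- (sum_count_occ N l), <- (sum_count_occ N l') in E; auto.
    2, 3: intros t Ht; apply HN; auto.
    assert (G : forall M, fold_right (fun p acc => Q2R (snd p) * fst p + acc) 0 (map (fun t => (t, c t)) M)
      = sumR (map (fun r => INR (count_occ Req_EM_T l r) * r) M)
        - sumR (map (fun r => INR (count_occ Req_EM_T l' r) * r) M)).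
    { induction M as [|t M IH]; simpl; [lra|]. rewrite IH.
      unfold c, Q2R. simpl. rewrite minus_IZR, <- !INR_IZR_INZ. lra. }
    rewrite G. lra. }
  destruct (in_dec Req_EM_T r N) as [Hr|Hr].
  - assert (HQ := HX (map (fun t => (t, c t)) N)).
    specialize (HQ ltac:(rewrite map_map; simpl; rewrite map_id; auto)).
    assert (HQ' : Qeq (snd (r, c r)) 0%Q).
    { apply HQ; auto.
      - intros q Hq. apply in_map_iff in Hq. destruct Hq as (t & <- & Ht). simpl.
        apply HN in Ht. destruct Ht; auto.
      - apply in_map_iff. eauto. }
    unfold c, Qeq in HQ'. simpl in HQ'. lia.
  - rewrite HN in Hr. rewrite !(proj1 (count_occ_not_In Req_EM_T _ _)); tauto.
Qed.

Definition cart (y : coord -> R) : pt := (y C1, y C2).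

Lemma tiles_unit_of p P : NoDup P ->
  (forall y, in_unit (cart y) <-> exists K, In K P /\ inside (unit_block p K) y) ->
  (forall K L y, In K P -> In L P -> inside (unit_block p K) y -> inside (unit_block p L) y -> K = L) ->
  tiles_unit (map (unit_block p) P).
Proof.
  intros ND Hc Hd y.
  assert (Z0 : forall l, (forall K, In K l -> ~ inside (unit_block p K) y) ->
    cnt (map (unit_block p) l) y = 0%nat).
  { intros l Hl. destruct (Nat.eq_dec (cnt (map (unit_block p) l) y) 0) as [e|n]; auto. exfalso.
    destruct (cnt_ex (map (unit_block p) l) y) as (B & HB & IB); [lia|].
    apply in_map_iff in HB. destruct HB as (K & <- & HK). eapply Hl; eauto. }
  assert (U : in_unit (cart y) <-> in_unit_ind y = 1%nat).
  { rewrite in_unit_ind_1. unfold in_unit, cart. split; intros H; intros []; simpl;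
      [apply (H C1)|apply (H C2)|apply (H C1)|apply (H C2)]. }
  destruct (Nat.eq_dec (in_unit_ind y) 1) as [e|n].
  - rewrite e. apply U, Hc in e. destruct e as (K & HK & IK).
    destruct (in_split _ _ HK) as (l1 & l2 & ->).
    apply NoDup_remove_2 in ND. rewrite in_app_iff in ND.
    assert (D : forall l, incl l (l1 ++ K :: l2) -> ~ In K l -> cnt (map (unit_block p) l) y = 0%nat).
    { intros l Hl Hn. apply Z0. intros L HL IL.
      assert (K = L) by (eapply Hd; eauto). subst; auto. }
    rewrite map_app, cnt_app, (D l1) by (try tauto; apply incl_appl, incl_refl).
    simpl. change (cnt (?a :: ?b) y) with (ind a y + cnt b y)%nat.
    rewrite (D l2) by (try tauto; apply incl_appr, incl_tl, incl_refl).
    apply ind_inside in IK. lia.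
  - rewrite Z0.
    + generalize (in_unit_ind_le y). lia.
    + intros K HK IK. apply n, U, Hc. eauto.
Qed.

Lemma inside_unit_block p K y :
  inside (unit_block p K) y <-> forall j, p K j <= y j < p K j + len j K.
Proof.
  unfold inside, hi. simpl. split; intros H j; generalize (H j); rewrite ?Rplus_0_r; auto.
Qed.

(** * Restricted shuffles as maps *)

Lemma in_rectb_true K x : in_rectb K x = true <-> rect_set K x.
Proof.
  unfold in_rectb, rect_set.
  destruct (Rle_dec (fst (rlo K)) (fst x)), (Rlt_dec (fst x) (fst (rhi K))),
    (Rle_dec (snd (rlo K)) (snd x)), (Rlt_dec (snd x) (snd (rhi K)));
    split; try discriminate; intros H; auto; try (intros []; simpl; lra);
    generalize (H C1) (H C2); simpl; lra.
Qed.

Lemma shuffle_out s x : ~ rect_set (sh_rect s) x -> shuffle s x = x.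
Proof.
  intros H. unfold shuffle. rewrite <- in_rectb_true in H.
  destruct (in_rectb (sh_rect s) x); tauto.
Qed.

Lemma shuffle_left s x : rect_set (sh_rect s) x -> pr (sh_coord s) x < sh_cut s ->
  shuffle s x = padd x (evec (sh_coord s) (pr (sh_coord s) (rhi (sh_rect s)) - sh_cut s)).
Proof.
  intros H H'. unfold shuffle. rewrite (proj2 (in_rectb_true _ _) H).
  destruct (Rlt_dec (pr (sh_coord s) x) (sh_cut s)); tauto.
Qed.

Lemma shuffle_right s x : rect_set (sh_rect s) x -> sh_cut s <= pr (sh_coord s) x ->
  shuffle s x = padd x (evec (sh_coord s) (- (sh_cut s - pr (sh_coord s) (rlo (sh_rect s))))).
Proof.
  intros H H'. unfold shuffle. rewrite (proj2 (in_rectb_true _ _) H).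
  destruct (Rlt_dec (pr (sh_coord s) x) (sh_cut s)); [lra|auto].
Qed.

Lemma pr_padd_evec i x t : pr i (padd x (evec i t)) = pr i x + t.
Proof. now destruct i. Qed.

Lemma pr_padd_evec_ot i x t : pr (ot i) (padd x (evec i t)) = pr (ot i) x.
Proof. destruct i; simpl; lra. Qed.

Lemma rect_set_dir i K x : rect_set K x <->
  (pr i (rlo K) <= pr i x < pr i (rhi K)) /\
  (pr (ot i) (rlo K) <= pr (ot i) x < pr (ot i) (rhi K)).
Proof.
  split; [intros H; split; apply H|]. intros [H1 H2] j.
  destruct (coord_cases i j) as [-> | ->]; auto.
Qed.

Lemma pt_ext x y : (forall i, pr i x = pr i y) -> x = y.
Proof. destruct x, y. intros H. generalize (H C1) (H C2). simpl. congruence. Qed.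

Lemma shuffle_cases s x : shuffle_valid s ->
  let i := sh_coord s in let K := sh_rect s in
  (~ rect_set K x /\ shuffle s x = x) \/
  (rect_set K x /\ rect_set K (shuffle s x) /\ pr (ot i) (shuffle s x) = pr (ot i) x /\
    (pr i x < sh_cut s /\ pr i (shuffle s x) = pr i x + (pr i (rhi K) - sh_cut s) \/
     sh_cut s <= pr i x /\ pr i (shuffle s x) = pr i x - (sh_cut s - pr i (rlo K)))).
Proof.
  intros [V1 V2] i K. destruct (Classical_Prop.classic (rect_set K x)) as [H|H].
  2: { left; split; auto. apply shuffle_out; auto. }
  right. split; auto. assert (H' := proj1 (rect_set_dir i K x) H).
  fold i K in V2.
  destruct (Rlt_le_dec (pr i x) (sh_cut s)) as [l|l].
  - rewrite (shuffle_left s x H l). fold i K.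
    rewrite (rect_set_dir i), pr_padd_evec, pr_padd_evec_ot. (split; [split; split; lra|split; [lra|left; split; lra]]).
  - rewrite (shuffle_right s x H l). fold i K.
    rewrite (rect_set_dir i), pr_padd_evec, pr_padd_evec_ot. (split; [split; split; lra|split; [lra|right; split; lra]]).
Qed.

(** A shuffle preserves its rectangle and translates the two parts to complementary positions. *)
Lemma shuffle_inj s x y : shuffle_valid s -> shuffle s x = shuffle s y -> x = y.
Proof.
  intros V E.
  assert (Hx := shuffle_cases s x V). assert (Hy := shuffle_cases s y V). simpl in Hx, Hy.
  destruct Hx as [[nx ex]|(Rx & Sx & ox & Hx)], Hy as [[ny ey]|(Ry & Sy & oy & Hy)]; try congruence.
  apply (rect_set_dir (sh_coord s)) in Rx, Ry. rewrite E in *.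
  apply pt_ext. intros j. destruct (coord_cases (sh_coord s) j) as [-> | ->]; lra.
Qed.

Lemma apply_seq_app rs rs' x : apply_seq (rs ++ rs') x = apply_seq rs' (apply_seq rs x).
Proof. apply fold_left_app. Qed.

Lemma apply_seq_inj rs x y : (forall s, In s rs -> shuffle_valid s) ->
  apply_seq rs x = apply_seq rs y -> x = y.
Proof.
  revert x y; induction rs as [|s rs IH]; simpl; auto. intros x y V E.
  apply (shuffle_inj s); auto.
Qed.

Lemma shuffle_seq_snoc P rs s : shuffle_seq_on P rs -> shuffle_on P (apply_seq rs) s ->
  shuffle_seq_on P (rs ++ [s]).
Proof.
  intros H Hs k t Hk. destruct (Nat.lt_ge_cases k (length rs)) as [l|l].
  - rewrite nth_error_app1 in Hk by auto. rewrite firstn_app.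
    replace (k - length rs)%nat with 0%nat by lia. rewrite firstn_O, app_nil_r. auto.
  - rewrite nth_error_app2 in Hk by auto.
    destruct (k - length rs)%nat as [|m] eqn:E; simpl in Hk.
    + injection Hk as <-. rewrite firstn_app, E, firstn_O, app_nil_r, firstn_all2 by auto. auto.
    + destruct m; discriminate.
Qed.

(** * Realising placements by sequences of shuffles *)

Definition realises (P : list rect) (rs : list shuffle_data) (p : placement) : Prop :=
  shuffle_seq_on P rs /\
  forall K x, In K P -> rect_set K x -> forall j, pr j (apply_seq rs x) = pr j x + (p K j - pr j (rlo K)).

Lemma realises_image P rs p K y : realises P rs p -> In K P ->
  (image_set (apply_seq rs) K y <-> forall j, p K j <= pr j y < p K j + len j K).
Proof.
  intros [_ H] HK. split.
  - intros (x & Hx & ->) j. rewrite (H K x HK Hx j). generalize (Hx j). unfold len. lra.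
  - intros Hy. set (z := fun j => pr j y - (p K j - pr j (rlo K))).
    assert (Ez : forall j, pr j (cart z) = z j) by now intros [].
    assert (Hz : rect_set K (cart z)).
    { intros j. rewrite Ez. unfold z. generalize (Hy j). unfold len. lra. }
    exists (cart z). split; auto. apply pt_ext. intros j.
    rewrite (H K _ HK Hz), Ez. unfold z. lra.
Qed.

Definition orient (i : coord) (a b : R) : pt := match i with C1 => (a, b) | C2 => (b, a) end.

Lemma pr_orient i a b : pr i (orient i a b) = a.
Proof. now destruct i. Qed.

Lemma pr_orient_ot i a b : pr (ot i) (orient i a b) = b.
Proof. now destruct i. Qed.

Lemma pr_upd i x t : pr i (upd i x t) = t.
Proof. now destruct i. Qed.

Lemma pr_upd_ot i x t : pr (ot i) (upd i x t) = pr (ot i) x.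
Proof. now destruct i. Qed.

Lemma all_dir i (X : coord -> Prop) : (forall j, X j) <-> X i /\ X (ot i).
Proof.
  split; [auto|]. intros [H1 H2] j. destruct (coord_cases i j) as [-> | ->]; auto.
Qed.

(** The shuffle acts on the union of the current images of [K] and [L], cut at their common side. *)
Lemma realises_step P p q rs : is_rect_partition P -> realises P rs p -> swap_step P p q ->
  exists s, realises P (rs ++ [s]) q.
Proof.
  intros (ND & ok & Hdis & _) HR (i & K & L & HK & HL & n & H1 & H2 & H3 & H4 & H5 & H6 & H7 & H8).
  assert (LK := len_pos _ ok K). assert (LL := len_pos _ ok L).
  generalize (LK i HK) (LK (ot i) HK) (LL i HL) (LL (ot i) HL). clear LK LL. intros K1 K2 L1 L2.
  set (s := mkShuffle (mkRect (orient i (p K i) (p K (ot i)))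
    (orient i (p K i + len i K + len i L) (p K (ot i) + len (ot i) K))) i (p K i + len i K)).
  assert (V : shuffle_valid s).
  { split; [intros j; destruct (coord_cases i j) as [-> | ->]|];
      simpl; rewrite ?pr_orient, ?pr_orient_ot; lra. }
  assert (IK : forall y, image_set (apply_seq rs) K y <-> rect_set (sh_left s) y).
  { intros y. rewrite (realises_image _ _ _ _ _ HR HK), (rect_set_dir i), (all_dir i). simpl.
    rewrite pr_upd, pr_upd_ot, !pr_orient, !pr_orient_ot. tauto. }
  assert (IL : forall y, image_set (apply_seq rs) L y <-> rect_set (sh_right s) y).
  { intros y. rewrite (realises_image _ _ _ _ _ HR HL), (rect_set_dir i), (all_dir i). simpl.
    rewrite pr_upd, pr_upd_ot, !pr_orient, !pr_orient_ot, H1, H2, H3. tauto. }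
  assert (IU : forall y, rect_set (sh_rect s) y <-> rect_set (sh_left s) y \/ rect_set (sh_right s) y).
  { intros y. rewrite !(rect_set_dir i). simpl.
    rewrite !pr_upd, !pr_upd_ot, !pr_orient, !pr_orient_ot. lra. }
  assert (Vrs : forall t, In t rs -> shuffle_valid t).
  { intros t Ht. apply In_nth_error in Ht. destruct Ht as (k & Hk). apply (proj1 HR k t Hk). }
  exists s. split.
  { apply shuffle_seq_snoc; [apply HR|]. split; [auto|]. split; eauto. }
  intros M x HM Hx.
  rewrite apply_seq_app. change (apply_seq [s] ?y) with (shuffle s y).
  assert (E := proj2 HR M x HM Hx).
  destruct (rect_eq_dec M K) as [->|nK]; [|destruct (rect_eq_dec M L) as [->|nL]].
  - assert (Y : rect_set (sh_left s) (apply_seq rs x)) by (apply IK; exists x; auto).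
    assert (Y' := proj2 (IU _) (or_introl Y)).
    apply (rect_set_dir i) in Y. simpl in Y. rewrite !pr_upd in Y.
    rewrite shuffle_left; simpl; auto; [|tauto].
    apply (all_dir i). rewrite pr_padd_evec, pr_padd_evec_ot, !E, pr_orient, H5, H6.
    split; lra.
  - assert (Y : rect_set (sh_right s) (apply_seq rs x)) by (apply IL; exists x; auto).
    assert (Y' := proj2 (IU _) (or_intror Y)).
    apply (rect_set_dir i) in Y. simpl in Y. rewrite !pr_upd in Y.
    rewrite shuffle_right; simpl; auto; [|tauto].
    apply (all_dir i). rewrite pr_padd_evec, pr_padd_evec_ot, !E, pr_orient, H4, H7, H1.
    split; lra.
  (* A point of [M] sent into the shuffled rectangle would, by injectivity of the sequence, also lie
     in [K] or [L]. *)
  - rewrite shuffle_out.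
    + intros j. rewrite E, H8; auto.
    + rewrite IU, <- IK, <- IL. intros [(z & Hz & Ez)|(z & Hz & Ez)];
        apply apply_seq_inj in Ez; auto; subst z; eapply Hdis; [| |exact nK|eauto| | |exact nL|eauto]; auto.
Qed.

Lemma realises_conn P p q : is_rect_partition P -> conn P p q ->
  forall rs, realises P rs p -> exists rs', realises P rs' q.
Proof.
  intros HP. induction 1 as [p q E|p q r St C IH]; intros rs HR.
  - exists rs. split; [apply HR|]. intros K x HK Hx j. rewrite <- E by auto. apply HR; auto.
  - destruct (realises_step _ _ _ _ HP HR St) as (s & HR'). eauto.
Qed.

Theorem mainTheorem18 (f : pt -> pt) (P : list rect) :
  in_Rec2 f -> associated P f -> setwise_Qfree P ->
  exists rs : list shuffle_data,
    shuffle_seq_on P rs /\ forall x, in_unit x -> f x = apply_seq rs x.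
Proof.
  intros [(Bij1 & Bij2 & Bij3) _] [HP Hf] HQ.
  assert (HP' := HP). destruct HP' as (ND & ok & Hdis & Hcov).
  assert (Hlo : forall K, In K P -> rect_set K (rlo K)).
  { intros K HK j. generalize (ok K HK j). lra. }
  assert (Hf' : forall K x, In K P -> rect_set K x -> forall j,
    pr j (f x) = pr j x + (pr j (f (rlo K)) - pr j (rlo K))).
  { intros K x HK Hx j. destruct (Hf K HK) as (v & Hv).
    rewrite (Hv x), (Hv (rlo K)) by auto. destruct j; simpl; lra. }
  (* Initial and final lower corners: [f] translates [K], so its image is the rectangle of the same
     size at [f (rlo K)]. *)
  set (p := fun K j => pr j (rlo K)). set (q := fun K j => pr j (f (rlo K))).
  assert (pr_cart : forall y j, pr j (cart y) = y j) by now intros y [].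
  assert (Ip : forall K y, inside (unit_block p K) y <-> rect_set K (cart y)).
  { intros K y. rewrite inside_unit_block. unfold p, len. split; intros H j; generalize (H j);
      rewrite pr_cart; lra. }
  assert (Iq : forall K y, In K P ->
    (inside (unit_block q K) y <-> exists x, rect_set K x /\ f x = cart y)).
  { intros K y HK. rewrite inside_unit_block. unfold q. split.
    - intros H. set (z := fun j => y j - (pr j (f (rlo K)) - pr j (rlo K))).
      assert (Hz : rect_set K (cart z)).
      { intros j. rewrite pr_cart. unfold z. generalize (H j). unfold len. lra. }
      exists (cart z). split; auto. apply pt_ext. intros j.
      rewrite (Hf' K), !pr_cart by auto. unfold z. lra.
    - intros (x & Hx & E) j. generalize (Hf' K x HK Hx j) (Hx j). rewrite E, pr_cart.
      unfold len. lra. }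
  assert (C : conn P p q).
  { apply tilings_conn; auto.
    - intros i l l'. apply Q_lin_indep_sum_inj, HQ.
    - apply tiles_unit_of; auto.
      + intros y. rewrite Hcov. split; intros (K & HK & H); exists K; split; auto; apply Ip; auto.
      + intros K L y HK HL. rewrite !Ip. intros H1 H2.
        destruct (rect_eq_dec K L) as [|n]; auto. destruct (Hdis K L HK HL n (cart y)); auto.
    - apply tiles_unit_of; auto.
      + intros y. split.
        * intros Hy. destruct (Bij3 _ Hy) as (x & Hx & E). apply Hcov in Hx.
          destruct Hx as (K & HK & Hx). exists K. split; auto. apply Iq; eauto.
        * intros (K & HK & H). apply Iq in H; auto. destruct H as (x & Hx & <-).
          apply Bij1, Hcov. eauto.
      (* Images of distinct rectangles are disjoint because [f] is injective on the square. *)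
      + intros K L y HK HL. rewrite !Iq by auto. intros (x & Hx & E) (x' & Hx' & E').
        destruct (rect_eq_dec K L) as [|n]; auto. exfalso.
        apply (Hdis K L HK HL n x). split; auto.
        replace x with x'; auto. apply Bij2; try congruence; apply Hcov; eauto. }
  destruct (realises_conn _ _ _ HP C []) as (rs & HR1 & HR2).
  (* The empty sequence realises the initial placement. *)
  { split; [intros [] s Hs; discriminate|]. intros K x _ _ j. unfold p. simpl. lra. }
  exists rs. split; auto. intros x Hx. apply Hcov in Hx. destruct Hx as (K & HK & Hx).
  apply pt_ext. intros j. rewrite (HR2 K), (Hf' K) by auto. reflexivity.
Qed.
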